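(* Let $\Gamma$ be an infinite, finitely generated abelian group, and let $S$ be a finite generating set of $\Gamma$ such that every element of $S$ has infinite order. If the Cayley graph $G=G(\Gamma,S)$ is one-ended, then $G$ has a Hamilton decomposition, i.e. the edge set of $G$ can be partitioned into the edge sets of pairwise edge-disjoint Hamiltonian double-rays of $G$.
   Context: For a finitely generated abelian group $(\Gamma,+)$ and a finite generating set $S$ of $\Gamma$, the Cayley graph $G(\Gamma,S)$ is the (undirected) multigraph with vertex set $\Gamma$ and edge multiset $\{(x,x+g) : x\in\Gamma,\ g\in S\}$, i.e. for each pair $(x,g)\in\Gamma\times S$ there is one edge joining $x$ and $x+g$ (so if $g$ and $-g$ are both in $S$, parallel edges occur). A double-ray is an infinite, connected, 2-regular (sub)graph. A Hamiltonian double-ray of a graph is a double-ray contained in it as a subgraph that includes every vertex. An infinite graph has a Hamilton decomposition if its edge set can be partitioned into edge-disjoint Hamiltonian double-rays. A locally finite, connected infinite graph is one-ended if deleting any finite set of vertices leaves exactly one infinite component. *)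

(* Defs.v *)
From Stdlib Require Import Relation_Operators.
From mathcomp Require Import all_boot all_order all_algebra.
From mathcomp Require Import finmap.
From mathcomp Require Import classical_sets functions cardinality.

Set Implicit Arguments.
Unset Strict Implicit.
Unset Printing Implicit Defensive.
Import Order.TTheory GRing.Theory Num.Theory.
Local Open Scope classical_set_scope.
Local Open Scope ring_scope.

(* The order of the two ends of an edge carries no meaning: graphs are         *)
(* undirected.                                                                 *)
Record multigraph := Multigraph {
  vertex : Type;
  edge : Type;
  ends : edge -> vertex * vertex }.

Record subgraph (G : multigraph) := Subgraph {
  verts : set (vertex G);
  edges : set (edge G);
  edges_sub : forall e, edges e -> verts (ends e).1 /\ verts (ends e).2 }.

Section Subgraphs.
Variable G : multigraph.
Implicit Types (H : subgraph G) (x y : vertex G) (X C : set (vertex G)).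

Definition adjacent H x y : Prop :=
  exists2 e, edges H e & ends e = (x, y) \/ ends e = (y, x).

Definition component_of H x : set (vertex G) :=
  [set y | verts H y /\ clos_refl_trans _ (adjacent H) x y].

Definition is_component H C : Prop :=
  exists2 x, verts H x & C = component_of H x.

Definition connected_subgraph H : Prop :=
  verts H !=set0 /\
  forall x y, verts H x -> verts H y -> clos_refl_trans _ (adjacent H) x y.

(* Pairs (edge, choice of one of its two ends), so that a loop contributes 2   *)
(* to the degree of its vertex.                                                *)
Definition half_edges H x : set (edge G * bool) :=
  [set h | edges H h.1 /\
           (if h.2 then (ends h.1).2 else (ends h.1).1) = x].

Definition regular_subgraph (k : nat) H : Prop :=
  forall x, verts H x -> (half_edges H x #= `I_k)%card.

Definition double_ray H : Prop :=
  [/\ infinite_set (verts H), connected_subgraph H & regular_subgraph 2 H].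

Definition Hamiltonian_double_ray H : Prop :=
  double_ray H /\ verts H = setT.

Definition delete_vertices X : subgraph G :=
  @Subgraph G (~` X) [set e | ~ X (ends e).1 /\ ~ X (ends e).2]
    (fun _ both_ends_kept => both_ends_kept).

End Subgraphs.

(* Meant for locally finite, connected, infinite graphs, such as the Cayley    *)
(* graph of an infinite abelian group with respect to a finite generating set. *)
Definition one_ended (G : multigraph) : Prop :=
  forall X : set (vertex G), finite_set X ->
  exists! C, is_component (delete_vertices X) C /\ infinite_set C.

Definition has_Hamilton_decomposition (G : multigraph) : Prop :=
  exists2 D : set (subgraph G),
    (forall H, D H -> Hamiltonian_double_ray H) &
    partition D (@edges G) [set: edge G].

(* One edge for every pair (x, g) in Gamma * S; if g and - g are both in S,    *)
(* then (x, g) and (x + g, - g) are distinct parallel edges.                   *)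
Definition Cayley_graph (Gamma : zmodType) (S : {fset Gamma}) : multigraph :=
  @Multigraph Gamma (Gamma * S)%type (fun e => (e.1, e.1 + fsval e.2)).

Definition generates (Gamma : zmodType) (S : {fset Gamma}) : Prop :=
  smallest (fun K : set Gamma => zmod_closed (mem K)) [set` S] = setT.

Definition infinite_order (Gamma : zmodType) (g : Gamma) : Prop :=
  forall n : nat, (0 < n)%N -> g *+ n != 0.

(* Main.v *)
Require Import Defs.
From Stdlib Require Import Relation_Operators.
From HB Require Import structures.
From mathcomp Require Import all_boot all_order all_algebra all_fingroup.
From mathcomp Require Import finmap.
From mathcomp Require Import boolp classical_sets functions cardinality.
From mathcomp Require Import zify ring.

Set Implicit Arguments.
Unset Strict Implicit.
Unset Printing Implicit Defensive.
Import Order.TTheory GRing.Theory Num.Theory.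
Local Open Scope classical_set_scope.
Local Open Scope ring_scope.

(** Colour the edge joining x and x + g by the generator g.  As g has infinite
    order, every colour class is a disjoint union of double-rays, namely the
    cosets of Z g.  The proof recolours the edges step by step, each time
    finitely many of them, so that every colour class remains a disjoint union
    of double-rays ([good]); call these double-rays strands.  Each step puts two
    prescribed vertices on the same strand of a prescribed colour and leaves
    alone the edges at the vertices of a prescribed finite set, which contains
    the paths made earlier ([merge]).  Running through all triples (colour,
    vertex, vertex), the colourings converge, and in the limit every colour
    class is spanning, 2-regular and connected, hence a Hamiltonian double-ray
    ([spanning_colouring], [colour_classes_decompose]).

    The only recolouring move exchanges the colours s and g on the square y,
    y + g, y + s, y + s + g, when its edges still have their original colours.
    In each of the two colours it cuts two parallel edges and reconnects the
    four loose ends crosswise.  No closed walk appears in a colour unless one of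
    the two new edges joins ends that were already joined to each other
    ([acyclic_reconnect]).  For s this is excluded by taking the two s-edges
    from different strands, and for g by placing the square where the lines of
    direction g through its corners are untouched ([swap_good]).

    Far out, each strand of colour s is straight in both directions: its two
    ends run along cosets of Z s, each with a sign.  If the cosets of x and x + g
    carry ends of the same sign that belong to different strands, a square far
    out on them joins the two strands ([join_rays]); the outer pieces of the two
    ends become a new strand.  If g is independent of s, the required lines of
    direction g are untouched as soon as the square is far enough out.  Since
    the graph has one end, some generator h is independent of s
    ([independent_direction]), for otherwise Gamma would be virtually cyclic and
    removing a finite slab would leave two infinite components.

    The combinatorial core is a matching argument.  Take a finite set of ends
    that contains with each end the other end of its strand, and pair off all of
    it but a and b into couples that differ by h.  Join the couples one after
    the other, skipping a couple that lies on one strand already.  The property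
    of containing the other end of each strand persists for the ends not yet
    used, so that finally a and b are the two ends of one strand
    ([join_pairs]).  All ends of an interval of rows o, o + h, o + 2h, ... can be
    paired in this way if a and b are left out, provided that these have the same
    sign and are an odd number of rows apart ([mem_window], [uniq_window]).
    That merges the strands of a and b ([merge_aligned]).  The same pairing
    moves one end of the strand of u to a row above everything that was touched,
    without losing an end of the strand of v ([relocate]).  From there the end
    travels freely, since joining it to an untouched coset just carries it over
    with the sign reversed ([step_over]); so it reaches the plane Z h + Z s
    through the end of v ([reachable_all]), acquires the right sign
    ([raise]), and, by one more relocation if need be, the right parity
    ([merge_level]). *)

(** * Linear identities in an abelian group *)

(** The square-zero extension of the integers by V, a commutative ring whose
    only purpose is to let [ring] decide identities in V: V embeds in it
    additively, and integer multiples become products. *)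
Definition triv_ext (V : zmodType) := (int * V)%type.

Section TrivialExtension.
Variable V : zmodType.
Local Notation R := (triv_ext V).

HB.instance Definition _ := GRing.Zmodule.on R.

Definition triv_mul (a b : R) : R := (a.1 * b.1, b.2 *~ a.1 + a.2 *~ b.1).

Fact triv_mulA : associative triv_mul.
Proof.
move=> [a x] [b y] [c z]; congr pair => /=; first by rewrite mulrA.
rewrite !mulrzDl !mulrzA addrA [z *~ b *~ a]mulrzAC.
by rewrite [y *~ c *~ a]mulrzAC.
Qed.

Fact triv_mulC : commutative triv_mul.
Proof. by move=> [a x] [b y]; congr pair => /=; rewrite 1?mulrC 1?addrC. Qed.

Fact triv_mul1 : left_id (1, 0) triv_mul.
Proof. by move=> [a x]; congr pair => /=; rewrite ?mul1r ?mul0rz ?addr0. Qed.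

Fact triv_mulDl : left_distributive triv_mul +%R.
Proof.
move=> [a x] [b y] [c z]; congr pair => /=; first by rewrite mulrDl.
by rewrite mulrzDr mulrzDl addrACA.
Qed.

Fact triv_1_neq0 : (1, 0) != 0 :> R.
Proof. by rewrite xpair_eqE. Qed.

HB.instance Definition _ := GRing.Zmodule_isComNzRing.Build R
  triv_mulA triv_mulC triv_mul1 triv_mulDl triv_1_neq0.

Definition triv_inj (x : V) : R := (0, x).

Fact triv_inj_additive : zmod_morphism triv_inj.
Proof. by move=> x y; congr pair; rewrite subr0. Qed.

HB.instance Definition _ := GRing.isZmodMorphism.Build V R triv_inj
  triv_inj_additive.

Lemma triv_inj_inj : injective triv_inj.
Proof. by move=> x y []. Qed.

End TrivialExtension.

Ltac zmod := apply: triv_inj_inj; ring.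

(** Together with [zmod], derives one linear equation from another. *)
Lemma eq_from_sub (V : zmodType) (a b x y : V) : a = b -> x - y = a - b -> x = y.
Proof. by move=> -> /eqP; rewrite subrr subr_eq0 => /eqP. Qed.

(** * Walks generated by two involutions *)

Section Walks.
Variables (T : eqType) (e fl : T -> T).
Hypotheses (eK : involutive e) (flK : involutive fl).
Hypotheses (e_neq : forall x, e x <> x) (fl_neq : forall x, fl x <> x).

(** In the application a point is a pair (vertex, slot), e crosses the edge at
    that slot, and fl turns to the other slot of the vertex reached. *)
Definition walk (x : T) : T := fl (e x).

Lemma iter_walk_rev k x y : iter k walk x = y -> iter k walk (fl y) = fl x.
Proof.
elim: k x => [|k IH] x; first by move=> /= ->.
by rewrite iterSr => /IH E; rewrite iterS E /walk flK eK.
Qed.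

(** A walk cannot come back along itself: its midpoint would be fixed by e or
    by fl. *)
Lemma iter_walk_neq_fl k x : iter k walk x <> fl x.
Proof.
suff [] : (forall x, iter k walk x <> fl x) /\
          (forall x, iter k.+1 walk x <> fl x) by [].
elim: k => [|k [IH1 IH2]].
  split=> y; first by move/esym; apply: fl_neq.
  by rewrite /= /walk => /(can_inj flK); apply: e_neq.
split=> // y; rewrite iterS iterSr {1}/walk => /(can_inj flK) E.
apply: (IH1 (walk y)); rewrite -[LHS]eK E.
by rewrite /walk flK.
Qed.

Definition acyclic_walk := forall k x, (0 < k)%N -> iter k walk x <> x.

End Walks.

Section Reconnect.
Variables (T : eqType) (e e' fl : T -> T).
Hypotheses (eK : involutive e) (flK : involutive fl).
Hypotheses (e_neq : forall x, e x <> x) (fl_neq : forall x, fl x <> x).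
Hypothesis acyc : acyclic_walk e fl.
Local Notation st := (walk e fl).
Local Notation st' := (walk e' fl).

Lemma iter_walk_eq_on (P : pred T) k x : {in predC P, e' =1 e} ->
  (forall i, (i < k)%N -> ~~ P (iter i st x)) -> iter k st' x = iter k st x.
Proof.
move=> ee'; elim: k => // k IH H.
rewrite !iterS IH => [|i lik]; last by apply: H; apply: ltnW.
by rewrite /walk ee' // inE; apply: H.
Qed.

(** Before its first visit to P a walk does not see that e was changed there. *)
Lemma iter_walk_hit (P : pred T) n x : {in predC P, e' =1 e} ->
  P (iter n st' x) ->
  exists k, [/\ (k <= n)%N, P (iter k st x) & iter k st' x = iter k st x].
Proof.
move=> ee'; elim: n x => [|n IH] x Pn; first by exists 0%N.
case Px: (P x); first by exists 0%N.
have Ex : st' x = st x by rewrite /walk ee' // inE Px.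
case: (IH (st x)) => [|k [kn Pk E]]; first by rewrite -Ex -iterSr.
by exists k.+1; split=> //; rewrite !iterSr // Ex.
Qed.

Variables p q : T.
Let P : pred T := fun x => x \in [:: p; q; e p; e q].
Hypothesis e'E : {in predC P, e' =1 e}.
Hypotheses (e'p : e' p = q) (e'q : e' q = p).
Hypotheses (e'ep : e' (e p) = e q) (e'eq : e' (e q) = e p).

(** A closed new walk through the new edge ab continues as an old walk from b
    to the next new edge.  Among the four places where it could arrive, only
    e a is consistent with the hypotheses; from there it crosses to e b and the
    only place left is a.  Then a -> e a -> b -> e b -> a would be a closed old
    walk. *)
Lemma iter_walk_neq_reconnect a b n :
    P =i mem [:: a; b; e a; e b] -> e' a = b -> e' (e a) = e b ->
    (forall k, iter k st (fl a) <> b) ->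
    (forall k, iter k st (fl (e a)) <> e b) ->
  (0 < n)%N -> iter n st' a <> a.
Proof.
move=> Pab e'a e'ea H1 H2; case: n => // n _; rewrite iterSr /walk e'a => E.
have Pm x : P x = (x \in [:: a; b; e a; e b]) by apply: Pab.
have Pa : P a by rewrite Pm inE eqxx.
have rev k x y := @iter_walk_rev _ e fl eK flK k x y.
have nfl k x := @iter_walk_neq_fl _ e fl eK flK e_neq fl_neq k x.
have [|k [kn + Ek]] := @iter_walk_hit P n (fl b) e'E; first by rewrite E.
rewrite Pm !inE => /or4P[] /eqP Hk.
- by apply: (H1 k); have := rev _ _ _ Hk; rewrite flK.
- by have := nfl k (fl b); rewrite flK; apply.
- have lt_kn : (k < n)%N.
    rewrite ltn_neqAle kn andbT; apply/eqP => kE; move: Ek.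
    by rewrite kE E -kE Hk => /esym; apply: e_neq.
  have E2 : iter (n - k.+1) st' (fl (e b)) = a.
    rewrite -[RHS]E -[X in iter X st' (fl b)](subnK lt_kn) iterD iterS Ek Hk.
    by rewrite /walk e'ea.
  have [|j [_ + Ej]] := @iter_walk_hit P (n - k.+1) (fl (e b)) e'E.
    by rewrite E2.
  rewrite Pm !inE => /or4P[] /eqP Hj.
  + have := acyc (k := (j + (k.+2))%N) (x := a); rewrite addnS; apply=> //.
    rewrite -addnS iterD iterS iterSr {2}/walk (_ : iter k st (fl (e a)) = b).
      by rewrite /walk.
    by have := rev _ _ _ Hk; rewrite flK.
  + by apply: (acyc (k := j.+1) (x := b)) => //; rewrite iterSr.
  + by apply: (H2 j); have := rev _ _ _ Hj; rewrite flK.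
  + by have := nfl j (fl (e b)); rewrite flK; apply.
- by apply: (acyc (k := k.+1) (x := e b)) => //; rewrite iterSr /walk eK.
Qed.

(** Replacing the edges p - e p and q - e q by p - q and e p - e q makes no closed
    walk, if neither of the new edges joins two ends of the same old path. *)
Lemma acyclic_reconnect :
    (forall k, iter k st (fl p) <> q) ->
    (forall k, iter k st (fl (e p)) <> e q) ->
  acyclic_walk e' fl.
Proof.
move=> H1 H2.
have rev k x y := @iter_walk_rev _ e fl eK flK k x y.
have H1' k : iter k st (fl q) <> p by move/rev; rewrite flK; apply: H1.
have H2' k : iter k st (fl (e q)) <> e p by move/rev; rewrite flK; apply: H2.
have PE a b : [\/ (a, b) = (p, q), (a, b) = (q, p), (a, b) = (e p, e q) |
                  (a, b) = (e q, e p)] -> P =i mem [:: a; b; e a; e b].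
  by case=> -[-> ->] x; rewrite !inE ?eK;
     case: (x == p); case: (x == q); case: (x == e p); case: (x == e q).
have main a n : P a -> (0 < n)%N -> iter n st' a <> a.
  rewrite /P !inE => /or4P[] /eqP -> n0.
  - by apply: (iter_walk_neq_reconnect (PE p q _)) => //; constructor.
  - by apply: (iter_walk_neq_reconnect (PE q p _)) => //; constructor.
  - by apply: (iter_walk_neq_reconnect (PE (e p) (e q) _)) => //;
      [constructor | rewrite ?eK | move=> k; rewrite ?eK].
  - by apply: (iter_walk_neq_reconnect (PE (e q) (e p) _)) => //;
      [constructor | rewrite ?eK | move=> k; rewrite ?eK].
move=> n x n0 En.
have [[i Pi]|no] := pselect (exists i, P (iter i st' x)).
  by apply: (main _ n Pi n0); rewrite -iterD addnC iterD En.
apply: (acyc n0 (x := x)); rewrite -[RHS]En; apply/esym.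
elim: (n) => // i IH; rewrite !iterS -IH /walk e'E // inE.
by apply/negP => Pi; apply: no; exists i.
Qed.

End Reconnect.

(** * Colourings by permutations of half-edges *)

Section Colourings.
Variables (Gamma : zmodType) (S : {fset Gamma}).
Hypothesis inf_order : forall g : Gamma, g \in S -> infinite_order g.
Implicit Types (s t g : S) (x y z w : Gamma) (b : bool) (h : S * bool).

Definition sgn b : int := if b then 1 else -1.

Lemma sgnN b : sgn (~~ b) = - sgn b.
Proof. by case: b. Qed.

Lemma mulz_eq0 s (n : int) : fsval s *~ n = 0 -> n = 0.
Proof.
have inf := inf_order (fsvalP s).
by case: n => [[|n]|n] // /eqP; rewrite ?NegzE ?mulrNz ?oppr_eq0 => E;
  have := inf n.+1 isT; rewrite E.
Qed.

Lemma mulz_inj s : injective (fun n : int => fsval s *~ n).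
Proof.
move=> m n /= E; apply/eqP; rewrite -subr_eq0; apply/eqP.
by apply: (mulz_eq0 (s := s)); rewrite mulrzBr E subrr.
Qed.

(** A slot (s, b) of a vertex is one of the two places where the strand of colour
    s passes through that vertex; a half-edge (g, true) at x is the beginning of
    the edge from x to x + g, and (g, false) the end of the edge from x - g to x.
    A colouring assigns half-edges to slots bijectively at each vertex, so that
    2-regularity of the colour classes holds by construction; the identity at every
    vertex gives the colouring by generators. *)
Definition colouring := Gamma -> {perm (S * bool)%type}.
Implicit Type pi : colouring.

Definition nbr x h : Gamma := x + fsval h.1 *~ sgn h.2.

Definition other_half h : S * bool := (h.1, ~~ h.2).

Lemma nbr_other_half x h : nbr (nbr x h) (other_half h) = x.
Proof. by rewrite /nbr sgnN mulrNz addrK. Qed.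

Lemma nbr_neq x h : nbr x h <> x.
Proof.
move/eqP; rewrite -subr_eq0 addrAC subrr add0r => /eqP /mulz_eq0.
by case: h.2.
Qed.

Lemma other_halfK : involutive other_half.
Proof. by move=> [s b]; rewrite /other_half negbK. Qed.

(** Follows the edge at a slot to the slot at its other end. *)
Definition cross pi (q : Gamma * (S * bool)) : Gamma * (S * bool) :=
  let k := pi q.1 q.2 in
  (nbr q.1 k, ((pi (nbr q.1 k))^-1)%g (other_half k)).

Arguments cross : simpl never.

Lemma crossK pi : involutive (cross pi).
Proof. by move=> [x h]; rewrite /cross /= permKV nbr_other_half other_halfK permK. Qed.

(** The two halves of an edge have the same colour. *)
Definition colour_ok pi := forall q, (cross pi q).2.1 = q.2.1.

Definition mate pi s (p : Gamma * bool) : Gamma * bool :=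
  let q := cross pi (p.1, (s, p.2)) in (q.1, q.2.2).

Arguments mate : simpl never.

Definition turn (p : Gamma * bool) : Gamma * bool := (p.1, ~~ p.2).

Definition step pi s := walk (mate pi s) turn.

Lemma turnK : involutive turn.
Proof. by move=> [x b]; rewrite /turn /= negbK. Qed.

Lemma turn_neq p : turn p <> p.
Proof. by case: p => x []. Qed.

Lemma cross_mate pi s p : colour_ok pi ->
  cross pi (p.1, (s, p.2)) = ((mate pi s p).1, (s, (mate pi s p).2)).
Proof.
move=> ok; rewrite /mate; have := ok (p.1, (s, p.2)).
by case: cross => x [t b] /= ->.
Qed.

Lemma mateK pi s : colour_ok pi -> involutive (mate pi s).
Proof.
move=> ok p; rewrite {1}/mate -cross_mate // crossK.
by case: p.
Qed.

Lemma mate_neq pi s p : mate pi s p <> p.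
Proof. by move/(congr1 fst); apply: nbr_neq. Qed.

(** Every colour class is a union of double-rays, and only finitely many vertices
    differ from the colouring by generators. *)
Definition good pi :=
  [/\ colour_ok pi, forall s, acyclic_walk (mate pi s) turn &
      exists A : seq Gamma, forall x, x \notin A -> pi x = 1%g].

Definition untouched pi s x := forall b, pi x (s, b) = (s, b).

Lemma cross_untouched pi s x b :
    untouched pi s x -> untouched pi s (nbr x (s, b)) ->
  cross pi (x, (s, b)) = (nbr x (s, b), (s, ~~ b)).
Proof.
move=> ux uy; rewrite /cross /= ux; congr pair.
by apply: (canLR (permK _)); rewrite uy.
Qed.

(** ** Exchanging two colours around a square *)

(** At each corner of the square one slot of colour s and one of colour g trade
    their half-edges; which ones depends on the side of the corner on which the
    square lies. *)
Definition corner y s g x : {perm (S * bool)%type} :=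
  if x == y then tperm (s, true) (g, true)
  else if x == y + fsval g then tperm (s, true) (g, false)
  else if x == y + fsval s then tperm (s, false) (g, true)
  else if x == y + fsval s + fsval g then tperm (s, false) (g, false)
  else 1%g.

Definition swap_square pi y s g : colouring := fun x => (corner y s g x * pi x)%g.

Lemma cornerK y s g x : involutive (corner y s g x).
Proof.
by rewrite /corner; do 4 (case: ifP => _; first exact: tpermK); move=> h; rewrite !perm1.
Qed.

Lemma cornerV y s g x : ((corner y s g x)^-1)%g = corner y s g x.
Proof. by apply/permP=> h; apply: (canRL (cornerK _ _ _ _)); rewrite permKV. Qed.

Definition recolour y s g (q : Gamma * (S * bool)) := (q.1, corner y s g q.1 q.2).

(** Since the change of slots is an involution at each vertex, the new adjacency
    is a conjugate of the old one. *)
Lemma cross_swap pi y s g q :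
  cross (swap_square pi y s g) q = recolour y s g (cross pi (recolour y s g q)).
Proof. by rewrite /recolour /cross /swap_square /= permM invMg cornerV permM. Qed.

Section Square.
Variables (pi : colouring) (y : Gamma) (s g : S).
Hypothesis ok : colour_ok pi.
Hypothesis not_mul : forall n : int, fsval g <> fsval s *~ n.
Let y1 := y + fsval g.
Let y2 := y + fsval s.
Let y3 := y + fsval s + fsval g.
Hypotheses (us0 : untouched pi s y) (ug0 : untouched pi g y).
Hypotheses (us1 : untouched pi s y1) (ug1 : untouched pi g y1).
Hypotheses (us2 : untouched pi s y2) (ug2 : untouched pi g y2).
Hypotheses (us3 : untouched pi s y3) (ug3 : untouched pi g y3).
Local Notation pi' := (swap_square pi y s g).

Lemma square_neq : [/\ s == g = false, g == s = false, y1 == y = false & y2 == y = false] /\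
  [/\ y3 == y = false, y2 == y1 = false, y3 == y1 = false & y3 == y2 = false].
Proof.
have no n (a c : Gamma) : c - a = (fsval s *~ n - fsval g) -> a == c = false.
  by move=> E; apply/eqP => ac; apply: (not_mul (n := n)); apply: (eq_from_sub ac);
    rewrite -[RHS]opprB E opprB.
have no0 n : n != 0 -> forall (a c : Gamma), a - c = fsval s *~ n -> a == c = false.
  move=> n0 a c E; apply/eqP => ac; have : fsval s *~ n = 0 by rewrite -E ac subrr.
  by move/mulz_eq0/eqP; apply/negP.
have gs : g == s = false by apply/eqP => E; apply: (not_mul (n := 1)); rewrite E.
split; split=> //.
- by rewrite eq_sym.
- by apply: (no 0); rewrite /y1; zmod.
- by apply: (no0 1) => //; rewrite /y2; zmod.
- by apply: (no (-1)); rewrite /y3; zmod.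
- by rewrite eq_sym; apply: (no 1); rewrite /y1 /y2; zmod.
- by apply: (no0 1) => //; rewrite /y3 /y1; zmod.
- by apply: (no 0); rewrite /y3 /y2; zmod.
Qed.

Let neqs := square_neq.

Lemma corner0 : corner y s g y = tperm (s, true) (g, true).
Proof. by rewrite /corner eqxx. Qed.

Lemma corner1 : corner y s g y1 = tperm (s, true) (g, false).
Proof. by case: neqs => -[? ? E ?] [????]; rewrite /corner E eqxx. Qed.

Lemma corner2 : corner y s g y2 = tperm (s, false) (g, true).
Proof. by case: neqs => -[? ? E E2] [? E3 ??]; rewrite /corner -/y1 -/y2 E2 E3 eqxx. Qed.

Lemma corner3 : corner y s g y3 = tperm (s, false) (g, false).
Proof.
by case: neqs => -[? ? E E2] [E4 E3 E5 E6]; rewrite /corner -/y1 -/y2 E4 E5 E6 eqxx.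
Qed.

Definition corner_slots : seq (Gamma * (S * bool)) :=
  [:: (y, (s, true)); (y1, (s, true)); (y2, (s, false)); (y3, (s, false));
      (y, (g, true)); (y1, (g, false)); (y2, (g, true)); (y3, (g, false))].

Lemma corner_id q : q \notin corner_slots -> corner y s g q.1 q.2 = q.2.
Proof.
case: q => x h; apply: contraNeq.
have tp (a c : S * bool) : tperm a c h != h -> (h == a) || (h == c).
  by case: tpermP => [->|->|_ _]; rewrite !eqxx ?orbT.
rewrite /corner -/y1 -/y2 -/y3 /= !inE !xpair_eqE.
do 4 (case: (x =P _) => _; first by
  move/tp/orP=> [] ->; rewrite ?orbT).
by rewrite perm1 eqxx.
Qed.

Lemma nbrs : [/\ nbr y (s, true) = y2, nbr y1 (s, true) = y3,
  nbr y2 (s, false) = y & nbr y3 (s, false) = y1] /\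
  [/\ nbr y (g, true) = y1, nbr y2 (g, true) = y3,
  nbr y1 (g, false) = y & nbr y3 (g, false) = y2].
Proof. by rewrite /nbr /y1 /y2 /y3 /=; split; split; zmod. Qed.

Lemma cross_square :
  [/\ cross pi (y, (s, true)) = (y2, (s, false)),
      cross pi (y1, (s, true)) = (y3, (s, false)),
      cross pi (y, (g, true)) = (y1, (g, false)) &
      cross pi (y2, (g, true)) = (y3, (g, false))].
Proof.
have [[n1 n2 n3 n4] [n5 n6 n7 n8]] := nbrs.
by split; rewrite cross_untouched ?n1 ?n2 ?n5 ?n6.
Qed.

Lemma cross_square_swap :
  [/\ cross pi' (y, (s, true)) = (y1, (s, true)),
      cross pi' (y2, (s, false)) = (y3, (s, false)),
      cross pi' (y, (g, true)) = (y2, (g, true)) &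
      cross pi' (y1, (g, false)) = (y3, (g, false))].
Proof.
have [c1 c2 c3 c4] := cross_square.
rewrite !cross_swap.
have -> : recolour y s g (y, (s, true)) = (y, (g, true)).
  by rewrite /recolour /= corner0 tpermL.
have -> : recolour y s g (y2, (s, false)) = (y2, (g, true)).
  by rewrite /recolour /= corner2 tpermL.
have -> : recolour y s g (y, (g, true)) = (y, (s, true)).
  by rewrite /recolour /= corner0 tpermR.
have -> : recolour y s g (y1, (g, false)) = (y1, (s, true)).
  by rewrite /recolour /= corner1 tpermR.
rewrite c1 c2 c3 c4; split; rewrite /recolour /=.
- by rewrite corner1 tpermR.
- by rewrite corner3 tpermR.
- by rewrite corner2 tpermL.
- by rewrite corner3 tpermL.
Qed.

Lemma cross_swap_id q : q \notin corner_slots -> cross pi' q = cross pi q.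
Proof.
have rc r : r \notin corner_slots -> recolour y s g r = r.
  by move=> H; rewrite /recolour corner_id // -surjective_pairing.
move=> qP; rewrite cross_swap rc // rc //.
have [c1 c2 c3 c4] := cross_square.
have d1 := canRL (crossK pi) c1; have d2 := canRL (crossK pi) c2.
have d3 := canRL (crossK pi) c3; have d4 := canRL (crossK pi) c4.
apply: contra qP; rewrite !inE.
by do 7?[case/orP]; move/eqP/(canRL (crossK pi))->;
  rewrite ?c1 ?c2 ?c3 ?c4 -?d1 -?d2 -?d3 -?d4 !eqxx ?orbT.
Qed.

Lemma swap_colour_ok : colour_ok pi'.
Proof.
move=> q; have [|/cross_swap_id ->] := boolP (q \in corner_slots); last exact: ok.
have [c1 c2 c3 c4] := cross_square_swap.
have d1 := canRL (crossK pi') c1; have d2 := canRL (crossK pi') c2.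
have d3 := canRL (crossK pi') c3; have d4 := canRL (crossK pi') c4.
by rewrite !inE; do 7?[case/orP]; move/eqP->;
  rewrite ?c1 ?c2 ?c3 ?c4 -?d1 -?d2 -?d3 -?d4.
Qed.

Lemma mate_swap_id t p : (p.1, (t, p.2)) \notin corner_slots ->
  mate pi' t p = mate pi t p.
Proof. by move=> H; rewrite /mate cross_swap_id. Qed.

End Square.

Lemma generates_ind : generates S -> forall P : Gamma -> Prop, P 0 ->
  (forall x y, P x -> P y -> P (x - y)) -> (forall g : S, P (fsval g)) ->
  forall x, P x.
Proof.
move=> gen P P0 PB PS x.
have : [set: Gamma] x by [].
rewrite -gen; apply => /=; split.
  by split=> [|y z]; rewrite !in_setE; [exact: P0|exact: PB].
by move=> y yS; apply: (PS [` yS]%fset).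
Qed.

Section SquareGood.
Variables (pi : colouring) (y : Gamma) (s g : S).
Hypothesis gd : good pi.
Hypothesis not_mul : forall n : int, fsval g <> fsval s *~ n.
Let y1 := y + fsval g.
Let y2 := y + fsval s.
Let y3 := y + fsval s + fsval g.
Hypothesis us : forall x, x \in [:: y; y1; y2; y3] -> untouched pi s x.
Hypothesis ug : forall x, x \in [:: y; y1; y2; y3] -> untouched pi g x.
Local Notation pi' := (swap_square pi y s g).

Lemma mate_square :
  [/\ mate pi s (y, true) = (y2, false), mate pi s (y1, true) = (y3, false),
      mate pi g (y, true) = (y1, false) & mate pi g (y2, true) = (y3, false)] /\
  [/\ mate pi' s (y, true) = (y1, true), mate pi' s (y2, false) = (y3, false),
      mate pi' g (y, true) = (y2, true) & mate pi' g (y1, false) = (y3, false)].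
Proof.
have [||||||||c1 c2 c3 c4] := @cross_square pi y s g;
  try (by apply: us; rewrite !inE eqxx ?orbT); try (by apply: ug; rewrite !inE eqxx ?orbT).
have [||||||||d1 d2 d3 d4] := @cross_square_swap pi y s g not_mul;
  try (by apply: us; rewrite !inE eqxx ?orbT); try (by apply: ug; rewrite !inE eqxx ?orbT).
have mE pi0 t x b : mate pi0 t (x, b) =
  ((cross pi0 (x, (t, b))).1, (cross pi0 (x, (t, b))).2.2) by [].
by split; split; rewrite !mE ?c1 ?c2 ?c3 ?c4 ?d1 ?d2 ?d3 ?d4.
Qed.

Lemma mate_swap_eq t p : (p.1, (t, p.2)) \notin corner_slots y s g ->
  mate pi' t p = mate pi t p.
Proof.
apply: mate_swap_id;
  try (by apply: us; rewrite !inE eqxx ?orbT); try (by apply: ug; rewrite !inE eqxx ?orbT).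
Qed.

(** The four hypotheses say that no new edge joins two ends of one old path, in
    colour s and in colour g. *)
Lemma swap_good :
    (forall k, iter k (step pi s) (y, false) <> (y1, true)) ->
    (forall k, iter k (step pi s) (y2, true) <> (y3, false)) ->
    (forall k, iter k (step pi g) (y, false) <> (y2, true)) ->
    (forall k, iter k (step pi g) (y1, true) <> (y3, false)) ->
  good pi'.
Proof.
move=> Hs1 Hs2 Hg1 Hg2; have [ok ac [A fA]] := gd.
have [[m1 m2 m3 m4] [n1 n2 n3 n4]] := mate_square.
have okpi' : colour_ok pi'.
  apply: swap_colour_ok => //;
  try (by apply: us; rewrite !inE eqxx ?orbT); try (by apply: ug; rewrite !inE eqxx ?orbT).
have [[sg gs e1 e2] [e3 e4 e5 e6]] := square_neq y not_mul.
split=> //; last first.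
  exists ([:: y; y1; y2; y3] ++ A) => x; rewrite mem_cat !inE !negb_or.
  move=> /andP[/and4P[/negPf x0 /negPf x1 /negPf x2 /negPf x3] xA].
  by rewrite /swap_square /corner x0 x1 x2 x3 mul1g fA.
move=> t; have [->|/negPf ts] := eqVneq t s.
  apply: (acyclic_reconnect (mateK s ok) turnK (@mate_neq _ _) turn_neq (ac s)
    (p := (y, true)) (q := (y1, true))); rewrite ?m1 ?m2 //.
  - move=> [x b]; rewrite !inE !xpair_eqE => H; apply: mate_swap_eq.
    rewrite !inE !xpair_eqE /= eqxx sg !andbF !orbF.
    by move: H; case: b; rewrite ?andbT ?andbF ?orbF.
  - by rewrite -n1 mateK.
  - by rewrite -n2 mateK.
have [->|/negPf tg] := eqVneq t g.
  apply: (acyclic_reconnect (mateK g ok) turnK (@mate_neq _ _) turn_neq (ac g)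
    (p := (y, true)) (q := (y2, true))); rewrite ?m3 ?m4 //.
  - move=> [x b]; rewrite !inE !xpair_eqE => H; apply: mate_swap_eq.
    rewrite !inE !xpair_eqE /= eqxx gs !andbF !orFb.
    by move: H; case: b; rewrite ?andbT ?andbF ?orbF.
  - by rewrite -n3 mateK.
  - by rewrite -n4 mateK.
move=> k x k0; have E : mate pi' t =1 mate pi t.
  by move=> p; apply: mate_swap_eq; rewrite !inE !xpair_eqE ts tg !andbF.
have -> : iter k (walk (mate pi' t) turn) x = iter k (walk (mate pi t) turn) x.
  by apply: eq_iter => p; rewrite /walk E.
exact: ac.
Qed.

End SquareGood.

(** * Strands and their straight ends *)

(** The m-th vertex of the straight ray of colour s leaving x with sign b. *)
Definition shift s b (m : nat) x : Gamma := x + fsval s *~ (sgn b * m%:Z).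

Lemma shift0 s b x : shift s b 0 x = x.
Proof. by rewrite /shift mulr0 addr0. Qed.

Lemma shiftD s b m n x : shift s b (m + n) x = shift s b m (shift s b n x).
Proof. by rewrite /shift; zmod. Qed.

Lemma shiftS s b m x : shift s b m.+1 x = nbr (shift s b m x) (s, b).
Proof. by rewrite /shift /nbr /=; zmod. Qed.

Lemma shift_inj s b x : injective (fun m => shift s b m x).
Proof.
move=> m n /= /addrI /mulz_inj; case: b => /=; rewrite ?mul1r ?mulN1r; first by case.
by move/oppr_inj; case.
Qed.

Definition clear pi s x b := forall m, untouched pi s (shift s b m x).

Definition conn pi s x y :=
  exists k b b', iter k (step pi s) (x, b) = (y, b').

Definition coset s x y := exists n : int, y = x + fsval s *~ n.

Lemma coset_refl s x : coset s x x.
Proof. by exists 0; rewrite mulr0z addr0. Qed.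

Lemma coset_sym s x y : coset s x y -> coset s y x.
Proof. by case=> n ->; exists (- n); zmod. Qed.

Lemma coset_trans s x y z : coset s x y -> coset s y z -> coset s x z.
Proof. by move=> [n ->] [m ->]; exists (n + m); zmod. Qed.

Lemma coset_shift s b m x : coset s x (shift s b m x).
Proof. by exists (sgn b * m%:Z). Qed.

Lemma coset_cases s x y : coset s x y -> forall b,
  (exists m, y = shift s b m x) \/ (exists m, x = shift s b m y).
Proof.
move=> [n ->] b.
wlog -> : b / b = true => [wl|].
  have [|[m E]|[m E]] := wl true; [by [] | |]; case: b => //.
  - by left; exists m.
  - by right; exists m; move: E; rewrite /shift /= => E; apply: (eq_from_sub (esym E)); zmod.
  - by right; exists m.
  - by left; exists m; move: E; rewrite /shift /= => E; apply: (eq_from_sub (esym E)); zmod.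
case: n => n; first by left; exists n; rewrite /shift; zmod.
by right; exists n.+1; rewrite NegzE /shift; zmod.
Qed.

Lemma mate_straight pi s x b : untouched pi s x -> untouched pi s (nbr x (s, b)) ->
  mate pi s (x, b) = (nbr x (s, b), ~~ b).
Proof. by move=> ux uy; rewrite /mate cross_untouched. Qed.

Lemma step_straight pi s x b : untouched pi s x -> untouched pi s (nbr x (s, b)) ->
  step pi s (x, b) = (nbr x (s, b), b).
Proof. by move=> ux uy; rewrite /step /walk mate_straight // /turn /= negbK. Qed.

Lemma step1 pi s x b : untouched pi s x -> (step pi s (x, b)).1 = nbr x (s, b).
Proof. by move=> ux; rewrite /step /walk /mate /cross /= ux. Qed.

Lemma iter_straight pi s x b m : clear pi s x b ->
  iter m (step pi s) (x, b) = (shift s b m x, b).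
Proof.
move=> cl; elim: m => [|m IH]; first by rewrite shift0.
by rewrite iterS IH step_straight -?shiftS.
Qed.

Lemma conn_shift pi s x b m : clear pi s x b -> conn pi s x (shift s b m x).
Proof. by move=> cl; exists m, b, b; apply: iter_straight. Qed.

Lemma eq_or_turn (p : Gamma * bool) b : p = (p.1, b) \/ p = turn (p.1, b).
Proof. by case: p b => x [] []; [left|right|right|left]. Qed.

Section Connection.
Variables (pi : colouring) (s : S).
Hypothesis ok : colour_ok pi.
Local Notation st := (step pi s).
Local Notation conn := (conn pi s).

Lemma iter_rev k p q : iter k st p = q -> iter k st (turn q) = turn p.
Proof. exact: iter_walk_rev (mateK s ok) turnK _ _ _. Qed.

Lemma iter_neq_turn k p : iter k st p <> turn p.
Proof. exact: iter_walk_neq_fl (mateK s ok) turnK (@mate_neq _ _) turn_neq _ _. Qed.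

Lemma conn_sym x y : conn x y -> conn y x.
Proof. by move=> [k [b [b' /iter_rev E]]]; exists k, (~~ b'), (~~ b). Qed.

Lemma conn_trans y x z : conn x y -> conn y z -> conn x z.
Proof.
move=> [k [b [b' E1]]] [l [d [d' E2]]].
have [E|E] : (y, d) = (y, b') \/ (y, d) = turn (y, b').
  exact: (@eq_or_turn (y, d) b').
  by exists (l + k)%N, b, d'; rewrite iterD E1 -E.
have := iter_rev E1; rewrite -E => E3.
have [le_kl|/ltnW le_lk] := leqP k l.
  exists (l - k)%N, (~~ b), d'.
  by move: E2; rewrite -{1}(subnK le_kl) iterD E3.
apply: conn_sym; exists (k - l)%N, d', (~~ b).
by move: E3; rewrite -{1}(subnK le_lk) iterD E2.
Qed.

(** An untouched coset is a strand on its own. *)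
Lemma conn_coset x y : (forall n : int, untouched pi s (x + fsval s *~ n)) ->
  conn x y -> coset s x y.
Proof.
move=> un [k [b [b' E]]]; have cl : clear pi s x b by move=> m; apply: un.
by move: E; rewrite iter_straight // => -[<- _]; apply: coset_shift.
Qed.

Definition disjoint_rays (p q : Gamma * bool) :=
  forall m n, shift s p.2 m p.1 <> shift s q.2 n q.1.

Lemma disjoint_rays_sym p q : disjoint_rays p q -> disjoint_rays q p.
Proof. by move=> H m n /esym; apply: H. Qed.

Definition clearp p := clear pi s p.1 p.2.

Lemma conn_meet p q m n : clearp p -> clearp q ->
  shift s p.2 m p.1 = shift s q.2 n q.1 -> conn p.1 q.1.
Proof.
move=> cp cq E; apply: (conn_trans (conn_shift m cp)).
by rewrite E; apply: conn_sym; apply: conn_shift.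
Qed.

Lemma conn_ends p q : clearp p -> clearp q -> disjoint_rays p q ->
  conn p.1 q.1 -> exists k, iter k st (turn p) = q.
Proof.
case: p q => x b [y c] cp cq dis [k [d [d' E]]] /=.
have [Ed|Ed] := @eq_or_turn (x, d) b.
  move: E; rewrite Ed /= iter_straight // => -[E _].
  by case: (dis k 0%N); rewrite shift0.
move: E; rewrite Ed => E; have [Ed'|Ed'] := @eq_or_turn (y, d') c.
  by exists k; rewrite E Ed'.
move: E; rewrite Ed' => /iter_rev; rewrite !turnK /= iter_straight // => -[E _].
by case: (dis 0%N k); rewrite shift0.
Qed.

(** Three disjoint straight rays on one strand are impossible: both others would
    be met by the walk leaving p backwards, and the walk stays on the first of
    them that it meets. *)
Lemma no_three_ends p q r : clearp p -> clearp q -> clearp r ->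
  disjoint_rays p q -> disjoint_rays p r -> disjoint_rays q r ->
  conn p.1 q.1 -> conn p.1 r.1 -> False.
Proof.
move=> cp cq cr pq pr qr /(conn_ends cp cq pq)[k Ek] /(conn_ends cp cr pr)[l El].
wlog le_kl : q r k l cq cr pq pr qr Ek El / (k <= l)%N => [wl|].
  have [|/ltnW] := leqP k l; first exact: (wl q r).
  by apply: (wl r q); rewrite //; apply: disjoint_rays_sym.
move: El; rewrite -(subnK le_kl) iterD Ek.
case: q r {pq pr Ek} cq cr qr => x b [y c] cq cr qr.
by rewrite iter_straight // => -[E _]; case: (qr (l - k)%N 0%N); rewrite shift0.
Qed.

End Connection.

(** The form in which finiteness is used throughout: if each point forbids at most
    one index, then finitely many points leave all large indices free. *)
Lemma eventually_none (T : eqType) (P : nat -> T -> Prop) (A : seq T) :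
    (forall a m n, P m a -> P n a -> m = n) ->
  exists N, forall m, (N <= m)%N -> forall a, a \in A -> ~ P m a.
Proof.
move=> uniqP; elim: A => [|a A [N HN]]; first by exists 0%N.
have [[m0 Pm0]|no] := pselect (exists m, P m a).
  exists (maxn N m0.+1) => m; rewrite geq_max => /andP[Nm m0m] a'.
  rewrite inE => /predU1P[->|/(HN m Nm)//] Pm.
  by move: m0m; rewrite (uniqP _ _ _ Pm Pm0) ltnn.
exists N => m Nm a'; rewrite inE => /predU1P[->|/(HN m Nm)//] Pm.
by apply: no; exists m.
Qed.

Lemma eventually_avoids (T : eqType) (f : nat -> T) (L : seq T) :
  injective f -> exists N, forall m, (N <= m)%N -> f m \notin L.
Proof.
move=> inj; have [a m n <-|N HN] := @eventually_none _ (fun m a => f m = a) L.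
  by move/esym/inj.
by exists N => m Nm; apply/negP => /(HN m Nm).
Qed.

Lemma shift_avoids s b x (L : seq Gamma) :
  exists N, forall m, (N <= m)%N -> shift s b m x \notin L.
Proof. exact: eventually_avoids (@shift_inj s b x). Qed.

(** A strand does not repeat, so it leaves the finite touched part for good, and
    from then on it can only go straight. *)
Lemma escape pi s p : good pi ->
  exists k, clearp pi s (iter k (step pi s) p).
Proof.
move=> [ok ac [A fA]]; pose f k := iter k (step pi s) p.
have inj : injective f.
  move=> k l; wlog lt_kl : k l / (k < l)%N.
    move=> wl; have [kl|lk|//] := ltngtP k l; first exact: wl.
    by move/esym/(wl _ _ lk).
  move=> E; case: (ac s (l - k)%N (f k)); first by rewrite subn_gt0.
  by rewrite /f -iterD subnK ?(ltnW lt_kl).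
have [N HN] := eventually_avoids [seq (a, b) | a <- A, b <- [:: true; false]] inj.
have un k : (N <= k)%N -> untouched pi s (f k).1.
  move=> /HN H b; rewrite fA ?perm1 //; apply: contra H => fk.
  by apply/allpairsP; exists (f k); split=> //; [case: (f k).2 | case: (f k)].
exists N; rewrite -/(f N); set q := f N.
suff E m : f (N + m)%N = (shift s q.2 m q.1, q.2).
  by move=> m; have := un (N + m)%N (leq_addr _ _); rewrite E.
elim: m => [|m IH]; first by rewrite addn0 shift0 /q -surjective_pairing.
have u1 := un (N + m)%N (leq_addr _ _); have := un (N + m.+1)%N (leq_addr _ _).
have E : f (N + m.+1)%N = step pi s (f (N + m)%N) by rewrite addnS.
by rewrite E IH => u2; move: u1 u2; rewrite IH => u1; rewrite step1 // shiftS; apply: step_straight.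
Qed.

Lemma escape_conn pi s x : good pi -> exists p, clearp pi s p /\ conn pi s x p.1.
Proof.
move=> gd; have [k cl] := escape s (x, true) gd.
exists (iter k (step pi s) (x, true)); split=> //.
by exists k, true, (iter k (step pi s) (x, true)).2; rewrite -surjective_pairing.
Qed.

Definition agree (X : seq Gamma) pi pi' := forall x, x \in X -> pi' x = pi x.

Lemma mate_agree pi pi' s p : pi' p.1 = pi p.1 ->
  pi' (mate pi s p).1 = pi (mate pi s p).1 -> mate pi' s p = mate pi s p.
Proof. by rewrite /mate /cross /= => -> ->. Qed.

Lemma iter_agree pi pi' s p k :
    (forall i, (i <= k)%N -> pi' (iter i (step pi s) p).1 = pi (iter i (step pi s) p).1) ->
  iter k (step pi' s) p = iter k (step pi s) p.
Proof.
elim: k => // k IH H; rewrite !iterS IH; last first.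
  by move=> i ik; apply: H; apply: leqW.
rewrite /step /walk (mate_agree (pi := pi)) //; first by apply: (H k).
by have := H k.+1 (leqnn _).
Qed.

(** Connections are protected by freezing the colouring at finitely many
    vertices. *)
Lemma conn_local pi s x y : conn pi s x y ->
  exists X, forall pi', agree X pi pi' -> conn pi' s x y.
Proof.
move=> [k [b [b' E]]].
exists [seq (iter i (step pi s) (x, b)).1 | i <- iota 0 k.+1] => pi' ag.
exists k, b, b'; rewrite (iter_agree (pi := pi)) // => i ik; apply: ag.
by apply/mapP; exists i => //; rewrite mem_iota /= add0n ltnS.
Qed.

Lemma swap_untouched_other pi y s g t x : t != s -> t != g ->
  untouched pi t x -> untouched (swap_square pi y s g) t x.
Proof.
move=> ts tg ut b; rewrite /swap_square permM /corner.
have neq a c : tperm (s, a) (g, c) (t, b) = (t, b).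
  by rewrite tpermD // xpair_eqE eq_sym ?(negPf ts) ?(negPf tg).
by do 4 (case: ifP => _; first by rewrite neq ut); rewrite perm1 ut.
Qed.

(** The square is placed at distance m on the two rays.  The hypothesis on large m
    keeps colour g acyclic: the lines of direction g through two of its corners
    are straight, and going straight never reverses the sign, whereas the
    dangerous connections would have to. *)
Lemma join_rays pi (X : seq Gamma) s g x b :
    good pi -> (forall n : int, fsval g <> fsval s *~ n) ->
    clear pi s x b -> clear pi s (x + fsval g) b -> ~ conn pi s x (x + fsval g) ->
    (exists N, forall m, (N <= m)%N -> forall n : int,
      untouched pi g (shift s b m x + fsval g *~ n)) ->
  exists pi', [/\ good pi', agree X pi pi', conn pi' s x (x + fsval g),
    (forall w, untouched pi s w -> (forall m, w <> shift s b m x) ->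
       (forall m, w <> shift s b m (x + fsval g)) -> untouched pi' s w) &
    forall t w, t != s -> t != g -> untouched pi t w -> untouched pi' t w].
Proof.
move=> gd nm cl cl' ncon [N0 HN0]; have [ok _ _] := gd.
have [N1 HN1] := shift_avoids s b x X.
have [N2 HN2] := shift_avoids s b (x + fsval g) X.
pose m := maxn N0 (maxn N1 N2).
have m0 : (N0 <= m)%N by rewrite leq_maxl.
have m1 : (N1 <= m)%N by rewrite /m maxnCA leq_maxl.
have m2 : (N2 <= m)%N by rewrite /m maxnA leq_maxr.
have le_m i (c : bool) : (i <= m -> i <= m + c)%N by move=> im; apply: leq_trans im (leq_addr _ _).
(* The base corner of the square is the nearer one on the ray for positive sign,
   and the farther one for negative sign. *)
pose y := shift s b (m + ~~ b) x.
have ug n (c : bool) : untouched pi g (shift s b (m + c) x + fsval g *~ n).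
  by apply: HN0; apply: le_m.
have y2E : y + fsval s = shift s b (m + b) x.
  by rewrite /y /shift; case: (b) => /=; rewrite ?addn0 ?addn1; zmod.
have shD i : shift s b i (x + fsval g) = shift s b i x + fsval g by rewrite /shift; zmod.
have y1E : y + fsval g = shift s b (m + ~~ b) (x + fsval g) by rewrite shD.
have y3E : y + fsval s + fsval g = shift s b (m + b) (x + fsval g) by rewrite y2E shD.
have us4 w : w \in [:: y; y + fsval g; y + fsval s; y + fsval s + fsval g] -> untouched pi s w.
  by rewrite y1E y3E y2E !inE => /or4P[] /eqP->; [apply: cl|apply: cl'|apply: cl|apply: cl'].
have ug4 w : w \in [:: y; y + fsval g; y + fsval s; y + fsval s + fsval g] -> untouched pi g w.
  rewrite y2E !inE => /or4P[] /eqP->.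
  - by have := ug 0 (~~ b); rewrite mulr0z addr0.
  - by have := ug 1 (~~ b).
  - by have := ug 0 b; rewrite mulr0z addr0.
  - by have := ug 1 b.
have ncon_m i : ~ conn pi s (shift s b i x) (shift s b i (x + fsval g)).
  move=> H; apply: ncon; apply: (conn_trans ok (conn_shift i cl)).
  by apply: (conn_trans ok H); apply: conn_sym => //; apply: conn_shift.
have gd' : good (swap_square pi y s g).
  apply: swap_good => // k E.
  - by apply: (ncon_m (m + ~~ b)%N); rewrite -y1E; exists k, false, true.
  - by apply: (ncon_m (m + b)%N); rewrite -y2E -y3E; exists k, true, false.
  - move: E; rewrite iter_straight // => j.
    exact: (ug (sgn false * j%:Z) (~~ b)).
  - move: E; rewrite iter_straight // => j.
    have := ug (sgn true * j%:Z + 1) (~~ b); rewrite -/y.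
    by have -> : y + fsval g *~ (sgn true * j%:Z + 1) = shift g true j (y + fsval g)
      by rewrite /shift; zmod.
exists (swap_square pi y s g).
have mem4 w : w \notin [:: y; y + fsval g; y + fsval s; y + fsval s + fsval g] ->
    swap_square pi y s g w = pi w.
  rewrite !inE !negb_or => /and4P[/negPf x0 /negPf x1 /negPf x2 /negPf x3].
  by rewrite /swap_square /corner x0 x1 x2 x3 mul1g.
have [[c1 c2 c3 c4] [d1 d2 d3 d4]] := mate_square nm us4 ug4.
split=> //.
- move=> w wX; apply: mem4; apply: contraL wX; rewrite y1E y3E y2E !inE.
  by case/or4P=> /eqP ->; [apply: HN1|apply: HN2|apply: HN1|apply: HN2]; apply: le_m.
- have [ok' _ _] := gd'.
  have out z : z = x \/ z = x + fsval g -> conn (swap_square pi y s g) s z (shift s b m z).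
    move=> zE; exists m, b, b.
    have clz : clear pi s z b by case: zE => ->.
    rewrite -(iter_straight m clz).
    apply: (iter_walk_eq_on (P := fun p => (p.1, (s, p.2)) \in corner_slots y s g)).
      by move=> p; rewrite inE => H; apply: mate_swap_eq.
    move=> i im; rewrite -/(step pi s) iter_straight //.
    have [[sg _ _ _] _] := square_neq y nm.
    have nE : (shift s b i z == shift s b m x) = false /\
              (shift s b i z == shift s b m (x + fsval g)) = false.
      split; apply/eqP; case: zE => -> E.
      - by move: im; rewrite (shift_inj E) ltnn.
      - apply: (nm (sgn b * m%:Z - sgn b * i%:Z)); apply: (eq_from_sub E).
        by rewrite /shift; zmod.
      - apply: (nm (sgn b * i%:Z - sgn b * m%:Z)); apply: (eq_from_sub (esym E)).
        by rewrite /shift; zmod.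
      - by move: im; rewrite (shift_inj E) ltnn.
    case: nE => nE1 nE2.
    rewrite !inE !xpair_eqE /= eqxx sg !andbF !orbF y1E y3E y2E /y.
    by case: (b) nE1 nE2 => /=; rewrite addn0 => -> ->; rewrite ?andbF.
  have stp : step (swap_square pi y s g) s (shift s b m x, b) =
             (shift s b m (x + fsval g), ~~ b).
    rewrite /step /walk; move: d1 d2; rewrite y1E y3E y2E /y.
    by case: (b) => /=; rewrite addn0 => H1 H2; rewrite ?H1 ?H2.
  apply: (conn_trans ok' (out x (or_introl erefl))).
  apply: (@conn_trans _ _ ok' (shift s b m (x + fsval g))).
    by exists 1%N, b, (~~ b).
  by apply: conn_sym => //; apply: out; right.
- move=> w uw w1 w2 c; rewrite mem4 //; rewrite y1E y3E y2E !inE !negb_or.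
  by apply/and4P; split; apply/eqP; do ?[exact: w1 | exact: w2].
- by move=> t w ts tg; apply: swap_untouched_other.
Qed.

Lemma freeze pi s (V : seq Gamma) : exists X, forall pi', agree X pi pi' ->
  forall x y, x \in V -> y \in V -> conn pi s x y -> conn pi' s x y.
Proof.
suff [X HX] : exists X, forall pi', agree X pi pi' ->
    forall p, p \in [seq (x, y) | x <- V, y <- V] -> conn pi s p.1 p.2 -> conn pi' s p.1 p.2.
  exists X => pi' /HX H x y xV yV; apply: (H (x, y)).
  by apply/allpairsP; exists (x, y).
elim: [seq _ | _ <- _, _ <- _] => [|p P [X HX]]; first by exists [::].
have [[X1 HX1]|nc] : (exists X1, forall pi', agree X1 pi pi' -> conn pi' s p.1 p.2) \/
    ~ conn pi s p.1 p.2.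
  by have [/conn_local|] := pselect (conn pi s p.1 p.2); [left|right].
  exists (X ++ X1) => pi' ag q; rewrite inE => /predU1P[-> _|qP].
    by apply: HX1 => x xX; apply: ag; rewrite mem_cat xX orbT.
  by apply: HX => // x xX; apply: ag; rewrite mem_cat xX.
exists X => pi' ag q; rewrite inE => /predU1P[-> //|qP].
exact: HX.
Qed.

(** * Merging two strands of one colour *)

(** ** Independent generators *)

Definition independent s t := forall m n : int, fsval t *~ m = fsval s *~ n -> m = 0.

Lemma independent_neq s t n : independent s t -> fsval t <> fsval s *~ n.
Proof. by move=> ind; rewrite -[fsval t]mulr1z => /ind. Qed.

Lemma independent_row s t (m n m' n' : int) : independent s t ->
  fsval t *~ m + fsval s *~ n = fsval t *~ m' + fsval s *~ n' -> m = m' /\ n = n'.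
Proof.
move=> ind E; have E1 : fsval t *~ (m - m') = fsval s *~ (n' - n).
  by apply: (eq_from_sub E); zmod.
have : m = m' by apply/eqP; rewrite -subr_eq0 (ind _ _ E1).
move=> mm; split=> //; move: E; rewrite mm => /addrI; exact: mulz_inj.
Qed.

(** Different points of the ray lie on different lines of direction t, and each
    touched vertex spoils only one of these. *)
Lemma eventually_untouched pi s t b x : good pi -> independent s t ->
  exists N, forall m, (N <= m)%N ->
  forall n : int, untouched pi t (shift s b m x + fsval t *~ n).
Proof.
move=> [_ _ [A fA]] ind.
pose P m a := exists n : int, shift s b m x + fsval t *~ n = a.
have [a m n [k Ek] [l]|N HN] := @eventually_none _ P A.
  rewrite -Ek => E; have [_] : l = k /\ sgn b * n%:Z = sgn b * m%:Z.
    by apply: (independent_row ind); apply: (eq_from_sub E); rewrite /shift; zmod.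
  by case: b {Ek E P} => /=; lia.
exists N => m Nm n c; rewrite fA ?perm1 //; apply/negP => /(HN m Nm); apply.
by exists n.
Qed.

Section OneColour.
Variables (s h : S).
Hypothesis indep : independent s h.

Definition up (p : Gamma * bool) := (p.1 + fsval h, p.2).

Definition ports (R W : seq (Gamma * bool)) := R ++ W ++ map up W.

(** Since a strand has just two ends, this says that L contains with each end the
    other end of its strand. *)
Definition partnered pi (L : seq (Gamma * bool)) :=
  forall p, p \in L -> exists2 q, q \in L & q <> p /\ conn pi s p.1 q.1.

Lemma perm_ports R (z : Gamma * bool) W : perm_eq (ports R (z :: W)) (z :: up z :: ports R W).
Proof.
apply/seq.permP => a; rewrite /ports /= !count_cat /= !count_cat /=; lia.
Qed.

(** Joining the couple z, up z hands the partner of z over to the partner of up z,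
    and what remains is again closed under taking partners.  If z and up z are
    partners, the couple may be dropped, since no third end lies on their
    strand. *)
Lemma join_pairs W pi X R :
    good pi -> uniq (ports R W) ->
    (forall p q, p \in ports R W -> q \in ports R W -> p <> q -> disjoint_rays s p q) ->
    (forall p, p \in ports R W -> clearp pi s p) ->
    partnered pi (ports R W) ->
  exists pi', [/\ good pi', agree X pi pi', partnered pi' R,
    (forall p, p \in R -> clearp pi' s p) &
    forall w, untouched pi s w ->
      (forall p m, p \in W ++ map up W -> w <> shift s p.2 m p.1) -> untouched pi' s w].
Proof.
elim: W pi X => [|z W IH] pi X gd.
  rewrite /ports /= cats0 => _ _ cl part; exists pi; split=> //.
have memE p : (p \in ports R (z :: W)) = (p \in z :: up z :: ports R W).
  exact: perm_mem (perm_ports R z W) p.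
rewrite (perm_uniq (perm_ports R z W)) /= inE negb_or => /and3P[/andP[/eqP zz' zL] z'L uL].
move=> dis cl part.
have [ok _ _] := gd.
have zin : z \in ports R (z :: W) by rewrite memE inE eqxx.
have z'in : up z \in ports R (z :: W) by rewrite memE !inE eqxx orbT.
have sub p : p \in ports R W -> p \in ports R (z :: W).
  by rewrite memE !inE => ->; rewrite !orbT.
have neqz p : p \in ports R W -> p <> z by move=> pL E; rewrite E (negPf zL) in pL.
have neqz' p : p \in ports R W -> p <> up z by move=> pL E; rewrite E (negPf z'L) in pL.
have subW : {subset W ++ map up W <= (z :: W) ++ map up (z :: W)}.
  by move=> p; rewrite /= !(in_cons, mem_cat) => /orP[] ->; rewrite ?orbT.
have [czz'|nczz'] := pselect (conn pi s z.1 (up z).1).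
  have [|||pi' [g' ag pR clR un]] := IH pi X gd uL.
  - by move=> p q /sub pL /sub; apply: dis.
  - by move=> p /sub; apply: cl.
  - move=> p pL; have [q + [qp pq]] := part p (sub _ pL).
    have cpz : conn pi s p.1 z.1 -> False.
      move=> c; apply: (no_three_ends ok (p := p) (q := z) (r := up z));
        do ?[exact: cl | apply: cl; exact: sub];
        do ?[apply: dis => //; do ?[exact: sub]]; do ?[exact: neqz | exact: neqz' | exact: c].
      exact: conn_trans c czz'.
    rewrite memE !inE => /or3P[/eqP E|/eqP E|qL]; last by exists q.
    + by case: cpz; rewrite -E.
    + by case: cpz; apply: (conn_trans ok pq); rewrite E; apply: conn_sym.
  exists pi'; split=> // w uw Hw; apply: un => // p m pW; apply: Hw.
  exact: subW.
(* The connections among the remaining ends must survive the join. *)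
have [Y HY] := freeze pi s (map fst (ports R (z :: W))).
have neq_h n := independent_neq (n := n) indep.
have [||pi1 [g1 ag1 c1 un1 _]] :=
  @join_rays pi (X ++ Y) s h z.1 z.2 gd neq_h (cl _ zin) _ nczz'.
- exact: (cl _ z'in).
- exact: eventually_untouched.
have ok1 : colour_ok pi1 by case: g1.
have frz p q : p \in ports R (z :: W) -> q \in ports R (z :: W) ->
    conn pi s p.1 q.1 -> conn pi1 s p.1 q.1.
  move=> pL qL; apply: HY; [|exact: map_f|exact: map_f].
  by move=> x xY; apply: ag1; rewrite mem_cat xY orbT.
have [|||pi' [g' ag pR clR un]] := IH pi1 X g1 uL.
- by move=> p q /sub pL /sub; apply: dis.
- move=> p pL m; apply: un1; first exact: (cl _ (sub _ pL)).
  + by move=> n; apply: (dis p z) => //; [exact: sub|exact: neqz].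
  + by move=> n; apply: (dis p (up z)) => //; [exact: sub|exact: neqz'].
- move=> p pL; have [q + [qp pq]] := part p (sub _ pL).
  rewrite memE !inE => /or3P[/eqP E|/eqP E|qL].
  + have [r + [rz zr]] := part (up z) z'in.
    rewrite memE !inE => /or3P[/eqP E1|/eqP //|rL].
      by case: nczz'; apply: conn_sym => //; move: zr; rewrite E1.
    rewrite E in pq; exists r => //; split.
      move=> E1; apply: nczz'; apply: (conn_trans ok (conn_sym ok pq)).
      by rewrite -E1; apply: conn_sym.
    apply: (conn_trans ok1 (frz p z (sub _ pL) zin pq)).
    by apply: (conn_trans ok1 c1); apply: (frz (up z) r) => //; apply: sub.
  + have [r + [rz zr]] := part z zin.
    rewrite memE !inE => /or3P[/eqP //|/eqP E1|rL].
      by case: nczz'; rewrite -E1.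
    rewrite E in pq; exists r => //; split.
      by move=> E1; apply: nczz'; apply: (conn_trans ok zr); rewrite E1.
    apply: (conn_trans ok1 (frz p (up z) (sub _ pL) z'in pq)).
    by apply: (conn_trans ok1 (conn_sym ok1 c1)); apply: (frz z r) => //; apply: sub.
  + by exists q => //; split=> //; apply: frz => //; apply: sub.
exists pi'; split=> //.
  by move=> x xX; rewrite ag // ag1 // mem_cat xX.
move=> w uw Hw; apply: un.
  apply: un1 => // m; first by apply: Hw; rewrite in_cons eqxx.
  by apply: (Hw (up z)); rewrite in_cons mem_cat in_cons eqxx !orbT.
move=> p m pW; apply: Hw.
exact: subW.
Qed.

Definition same_line x y := exists m n : int, y = x + fsval h *~ m + fsval s *~ n.

(** The points of O serve as origins of rows, one for each plane, that is, for each
    coset of Z h + Z s that matters. *)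
Definition transversal (O : seq Gamma) :=
  forall x y, x \in O -> y \in O -> same_line x y -> x = y.

Lemma same_line_sym x y : same_line x y -> same_line y x.
Proof. by move=> [m [n ->]]; exists (- m), (- n); zmod. Qed.

Lemma same_line_trans x y z : same_line x y -> same_line y z -> same_line x z.
Proof. by move=> [m [n ->]] [k [l ->]]; exists (m + k), (n + l); zmod. Qed.

Lemma row_unique O o o' k k' w : transversal O -> o \in O -> o' \in O ->
    coset s (o + fsval h *+ k) w -> coset s (o' + fsval h *+ k') w ->
  o = o' /\ k = k'.
Proof.
move=> tr oO o'O [m E] [n E'].
have eo : o = o'.
  apply: tr => //; exists (k%:Z - k'%:Z), (m - n).
  by apply: (eq_from_sub (etrans (esym E') E)); zmod.
split=> //; move: E'; rewrite E -eo => E'.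
have [] : k%:Z = k'%:Z /\ m = n.
  by apply: (independent_row indep); apply: (eq_from_sub E'); zmod.
by case.
Qed.

(** Finitely many points are covered by the rows 0, ..., 4i + 1 of finitely many
    planes, with x1 in the even row 2i of its own plane. *)
Lemma exists_window x1 (A : seq Gamma) : exists (O : seq Gamma) (i : nat),
  [/\ uniq O, transversal O, x1 - fsval h *+ i.*2 \in O &
      forall a, a \in A -> exists o k,
        [/\ o \in O, (k < (i.*2.+1).*2)%N & coset s (o + fsval h *+ k) a]].
Proof.
have [O [uO tr x1O HO]] : exists O : seq Gamma, [/\ uniq O, transversal O, x1 \in O &
    forall a, a \in A -> exists2 o, o \in O & same_line o a].
  elim: A => [|a A [O [uO tr x1O HO]]].
    exists [:: x1]; split=> //; last by rewrite inE.
    by move=> x y; rewrite !inE => /eqP-> /eqP->.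
  have [[o oO oa]|no] := pselect (exists2 o, o \in O & same_line o a).
    exists O; split=> // a'; rewrite inE => /predU1P[->|/HO //].
    by exists o.
  exists (a :: O); split=> /=.
  - rewrite uO andbT; apply/negP => aO; apply: no; exists a => //.
    by exists 0, 0; rewrite !mulr0z !addr0.
  - move=> x y; rewrite !inE => /predU1P[->|xO] /predU1P[->|yO] //.
    + by move=> /same_line_sym ya; case: no; exists y.
    + by move=> xa; case: no; exists x.
    + exact: tr.
  - by rewrite inE x1O orbT.
  - move=> a'; rewrite inE => /predU1P[->|/HO [o oO oa]].
      by exists a; rewrite ?inE ?eqxx //; exists 0, 0; rewrite !mulr0z !addr0.
    by exists o => //; rewrite inE oO orbT.
have [i Hi] : exists i : nat, forall a, a \in A -> exists o (m : int),
    [/\ o \in O, `|m| <= i%:Z & coset s (o + fsval h *~ m) a].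
  elim: A HO => [|a A IH] HO; first by exists 0%N.
  have [|i Hi] := IH; first by move=> a' a'A; apply: HO; rewrite inE a'A orbT.
  have [|o oO [m [n E]]] := HO a; first by rewrite inE eqxx.
  exists (i + absz m)%N => a'; rewrite inE => /predU1P[->|/Hi [o' [m' [o'O m'i c]]]].
    by exists o, m; split=> //; [lia|exists n].
  by exists o', m'; split=> //; lia.
exists [seq o - fsval h *+ i.*2 | o <- O], i; split.
- by rewrite map_inj_uniq // => x y /addIr.
- move=> x y /mapP[o oO ->] /mapP[o' o'O ->] [m [n E]]; congr (_ - _).
  by apply: tr => //; exists m, n; apply: (eq_from_sub E); zmod.
- exact: map_f.
- move=> a /Hi [o [m [oO mi [n ->]]]]; exists (o - fsval h *+ i.*2), (absz (m + (i.*2)%:Z)).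
  split; [exact: map_f | lia |].
  exists n; have -> : fsval h *+ absz (m + (i.*2)%:Z) = fsval h *~ (m + (i.*2)%:Z).
    by rewrite -[LHS]/(fsval h *~ (Posz _)) gez0_abs //; lia.
  by zmod.
Qed.

(** ** Pairing the ends in a window of rows *)

(** The label (o, k, b) stands for the end of sign b in row k over the origin o.
    All labels of the rows below 2n are paired with their upper neighbour, except
    for the two exposed labels of sign b1 over o1, in the rows 2i and 2j + 1. *)

Section Window.
Variables (O : seq Gamma) (o1 : Gamma) (b1 : bool) (i j n : nat).
Hypotheses (uO : uniq O) (trO : transversal O) (o1O : o1 \in O).
Hypotheses (le_ij : (i <= j)%N) (lt_jn : (j < n)%N).
Implicit Type l : Gamma * nat * bool.

Definition labels : seq (Gamma * nat * bool) :=
  [seq (ok, b) | ok <- [seq (o, k) | o <- O, k <- iota 0 n.*2], b <- [:: true; false]].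

(** The lower members of the couples.  Taking out row 2i shifts the couples above it
    to odd rows, and taking out row 2j + 1 shifts them back. *)
Definition low l : bool :=
  let k := l.1.2 in
  if (l.1.1 == o1) && (l.2 == b1) then
    [|| (k < i.*2)%N && ~~ odd k, (i.*2 < k < j.*2.+1)%N && odd k |
        (j.*2.+1 < k)%N && ~~ odd k]
  else ~~ odd k.

Definition upl l := (l.1.1, l.1.2.+1, l.2).

Definition lows := filter low labels.
Definition exposed := [:: (o1, i.*2, b1); (o1, j.*2.+1, b1)].
Definition window := exposed ++ lows ++ map upl lows.

Lemma mem_labels l : (l \in labels) = (l.1.1 \in O) && (l.1.2 < n.*2)%N.
Proof.
case: l => [[o k] b]; apply/allpairsP/andP => /=.
  move=> [[ok b'] /= [/allpairsP[[o' k'] /= [o'O + ->]] _ [-> -> _]]].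
  by rewrite mem_iota.
move=> [oO kn]; exists ((o, k), b); split=> //; last by case: b.
by apply/allpairsP; exists (o, k); split=> //; rewrite mem_iota.
Qed.

Lemma uniq_labels : uniq labels.
Proof.
apply: allpairs_uniq => //; last by move=> [x b] [y c] _ _ /= [-> ->].
by apply: allpairs_uniq; rewrite ?iota_uniq // => -[x b] [y c] _ _ /= [-> ->].
Qed.

Lemma upl_inj : injective upl.
Proof. by move=> [[o k] b] [[o' k'] b'] [-> -> ->]. Qed.

Lemma mem_window l : (l \in window) = (l.1.1 \in O) && (l.1.2 < n.*2)%N.
Proof.
rewrite !mem_cat !inE mem_filter mem_labels; case: l => [[o k] b] /=.
apply/idP/andP.
  case/or3P => [/orP[] /eqP[-> -> _]|/andP[_ /andP[-> ->]]//|/mapP[[[o' k'] b']]].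
  - by split=> //; lia.
  - by split=> //; lia.
  rewrite mem_filter mem_labels /= => /andP[lo /andP[o'O k'n]] [-> -> _]; split=> //.
  by move: lo; rewrite /low /=; case: ifP => _; lia.
move=> [oO kn].
have [lo|nlo] := boolP (low (o, k, b)); first by rewrite oO kn orbT.
have [ex|nex] := boolP (((o, k, b) == (o1, i.*2, b1)) || ((o, k, b) == (o1, j.*2.+1, b1))).
  by [].
case: k kn nlo nex => [|k] kn nlo nex.
  move: nlo nex; rewrite /low /= !xpair_eqE.
  by case: (o == o1); case: (b == b1) => //=; lia.
apply/orP; right; apply/orP; right; apply/mapP; exists (o, k, b) => //.
rewrite mem_filter mem_labels /= oO (ltnW kn) !andbT.
move: nlo nex; rewrite /low /= !xpair_eqE.
by case: (o == o1); case: (b == b1) => //=; lia.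
Qed.

Lemma uniq_window : uniq window.
Proof.
have ul : uniq lows by apply: filter_uniq; apply: uniq_labels.
rewrite !cat_uniq ul map_inj_uniq ?ul ?andbT //; last exact: upl_inj.
apply/and3P; split.
- by rewrite /= inE !xpair_eqE eqxx /=; lia.
- apply/hasPn => l; rewrite mem_cat mem_filter !inE negb_or => /orP[/andP[lo _]|].
    apply/andP; split; apply/eqP => E; move: lo; rewrite E /low /= !eqxx /=; lia.
  move=> /mapP[[[o k] b]]; rewrite mem_filter => /andP[lo _] ->; rewrite !xpair_eqE.
  by move: lo; rewrite /low /=; case: (o == o1); case: (b == b1) => //=; lia.
- apply/hasPn => l /mapP[[[o k] b]]; rewrite !mem_filter => /andP[lo _] ->.
  apply/negP => /andP[lo' _]; move: lo lo'.
  by rewrite /low /=; case: ifP => _; lia.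
Qed.

(** The ray of a label, started at distance N from the row's origin so that the
    two rays in one row are disjoint. *)
Definition port N l : Gamma * bool :=
  (shift s l.2 N (l.1.1 + fsval h *+ l.1.2), l.2).

Lemma up_port N l : up (port N l) = port N (upl l).
Proof. by rewrite /up /port /shift /upl /=; congr pair; zmod. Qed.

Lemma disjoint_ports N l l' : (0 < N)%N -> l \in window -> l' \in window -> l <> l' ->
  disjoint_rays s (port N l) (port N l').
Proof.
move=> N0; rewrite !mem_window; case: l l' => [[o k] b] [[o' k'] b'] /=.
move=> /andP[oO _] /andP[o'O _] ne m m' /= E; apply: ne.
have := row_unique trO oO o'O; rewrite -!shiftD in E => /(_ k k').
move=> /(_ _ (coset_shift s b (m + N) _)); rewrite {1}E => /(_ (coset_shift _ _ _ _)) [eo kk'].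
congr (_, _, _) => //; move: E; rewrite eo kk' /shift => /addrI/mulz_inj.
by case: b; case: b' => //=; lia.
Qed.

Lemma port_inj N : (0 < N)%N -> {in window &, injective (port N)}.
Proof.
move=> N0 l l' lw l'w E; apply/eqP/negPn/negP => /eqP ne.
by have /(_ 0%N 0%N) := disjoint_ports N0 lw l'w ne; rewrite E.
Qed.

Definition row_of x := exists o k, [/\ o \in O, (k < n.*2)%N & coset s (o + fsval h *+ k) x].

Lemma row_of_port N l : l \in window -> coset s (l.1.1 + fsval h *+ l.1.2) (port N l).1.
Proof. by move=> _; apply: coset_shift. Qed.

(** The other end of a strand that has an end in the window runs in a coset which
    either contains touched vertices, and then is a row of the window by
    hypothesis, or is untouched, and then is the row of the given end. *)
Lemma partnered_window pi N : good pi -> (0 < N)%N ->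
    (forall x, ~ untouched pi s x -> row_of x) ->
    (forall l, l \in window -> clearp pi s (port N l)) ->
  partnered pi (map (port N) window).
Proof.
move=> gd N0 cov cl p /mapP[l lw ->]; have [ok _ _] := gd.
set p0 := port N l; have [k] := escape s (turn p0) gd.
case Eq : (iter k _ _) => [y c] cly.
have cpy : conn pi s p0.1 y by exists k, (~~ p0.2), c.
have [o [r [oO rn [m yE]]]] : row_of y.
  have [[a na]|un] := pselect (exists a : int, ~ untouched pi s (y + fsval s *~ a)).
    have [o [r [oO rn co]]] := cov _ na; exists o, r; split=> //.
    by apply: coset_trans co _; apply: coset_sym; exists a.
  have ya : coset s y p0.1.
    apply: conn_coset (conn_sym ok cpy) => a; apply: contrapT => na.
    by apply: un; exists a.
  have := lw; rewrite mem_window => /andP[lO ln]; exists l.1.1, l.1.2; split=> //.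
  exact: coset_trans (row_of_port N lw) (coset_sym ya).
have l'w : (o, r, c) \in window by rewrite mem_window /= oO rn.
set q0 := port N (o, r, c); exists q0; first exact: map_f.
have clq := cl _ l'w.
have cqy : coset s q0.1 y.
  by apply: coset_trans (coset_sym (row_of_port N l'w)) _; exists m.
have rev := iter_rev ok (s := s); have nt := iter_neq_turn ok (s := s).
case: (coset_cases cqy c) => -[a E]; split.
- move=> qp; have E1 : iter k (step pi s) (turn p0) = iter a (step pi s) p0.
    by rewrite Eq -qp (iter_straight _ clq) E.
  apply: (nt (a + k)%N (turn (iter a (step pi s) p0))).
  by rewrite turnK iterD (rev _ _ _ E1) turnK.
- by apply: (conn_trans ok cpy); apply: conn_sym => //; rewrite E; apply: conn_shift.
- move=> qp; apply: (nt (a + k)%N (turn p0)).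
  by rewrite turnK iterD Eq iter_straight // -E -qp.
- by apply: (conn_trans ok cpy); rewrite E; apply: conn_shift.
Qed.

Lemma join_window pi (X : seq Gamma) N (R0 W0 : seq (Gamma * nat * bool)) :
    good pi -> (0 < N)%N ->
    (forall x, ~ untouched pi s x -> row_of x) ->
    (forall l, l \in window -> clearp pi s (port N l)) ->
    perm_eq (R0 ++ W0 ++ map upl W0) window ->
  exists pi', [/\ good pi', agree X pi pi', partnered pi' (map (port N) R0),
    (forall l, l \in R0 -> clearp pi' s (port N l)) &
    (forall x, untouched pi s x -> ~ row_of x -> untouched pi' s x)].
Proof.
move=> gd N0 cov cl pw.
have E : ports (map (port N) R0) (map (port N) W0) =
         map (port N) (R0 ++ W0 ++ map upl W0).
  by rewrite /ports !map_cat -!map_comp; do 2 congr (_ ++ _); apply: eq_map => l;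
    apply: up_port.
have inw l : (l \in R0 ++ W0 ++ map upl W0) = (l \in window) by apply: perm_mem.
have [||||pi' [g' ag pR clR un]] := @join_pairs (map (port N) W0) pi X (map (port N) R0) gd.
- rewrite E map_inj_in_uniq ?(perm_uniq pw) ?uniq_window //.
  by move=> l l'; rewrite !inw; apply: port_inj.
- move=> p q; rewrite E => /mapP[l + ->] /mapP[l' + ->]; rewrite !inw => lw l'w ne.
  by apply: disjoint_ports => // ll'; apply: ne; rewrite ll'.
- by move=> p; rewrite E => /mapP[l + ->]; rewrite inw; apply: cl.
- rewrite E => p /mapP[l lw ->].
  have [|q /mapP[l' l'w ->] qp] := partnered_window gd N0 cov cl (p := port N l).
    by apply: map_f; rewrite -inw.
  by exists (port N l') => //; apply: map_f; rewrite inw.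
exists pi'; split=> //; first by move=> l lR; apply: clR; apply: map_f.
move=> x ux nx; apply: un => // p m pW xE; apply: nx.
have : p \in ports (map (port N) R0) (map (port N) W0) by rewrite mem_cat pW orbT.
rewrite E => /mapP[l + pE]; rewrite inw => lw; have := lw; rewrite mem_window => /andP[lO ln].
exists l.1.1, l.1.2; split=> //; rewrite xE pE.
by apply: coset_trans (row_of_port N lw) _; apply: coset_shift.
Qed.

End Window.

Lemma untouched_support pi : good pi -> exists A : seq Gamma, forall t x,
  ~ untouched pi t x -> x \in A.
Proof.
move=> [_ _ [A fA]]; exists A => t x nu; apply/negPn/negP => /fA E.
by apply: nu => b; rewrite E perm1.
Qed.

Lemma far_ports pi (L : seq (Gamma * nat * bool)) : good pi ->
  exists2 N, (0 < N)%N & forall l, l \in L -> clearp pi s (port N l).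
Proof.
move=> /untouched_support [A HA].
suff [N HN] : exists N, forall m, (N <= m)%N -> forall l, l \in L -> clearp pi s (port m l).
  by exists N.+1 => // l; apply: HN.
elim: L => [|l L [N HN]]; first by exists 0%N.
have [M HM] := shift_avoids s l.2 (l.1.1 + fsval h *+ l.1.2) A.
exists (maxn N M) => m; rewrite geq_max => /andP[Nm Mm] l'.
rewrite inE => /predU1P[->|/(HN m Nm)//] k; apply: contrapT => /HA.
by rewrite -shiftD; apply/negP/HM; apply: leq_trans (leq_addl _ _).
Qed.

Lemma conn_clear_coset pi x y b : colour_ok pi -> clear pi s x b -> clear pi s y b ->
  coset s x y -> conn pi s x y.
Proof.
move=> ok cx cy /coset_cases/(_ b) [] [m ->]; last apply: conn_sym => //; exact: conn_shift.
Qed.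

Lemma agree_trans X pi1 pi2 pi3 : agree X pi1 pi2 -> agree X pi2 pi3 -> agree X pi1 pi3.
Proof. by move=> a b x xX; rewrite b // a. Qed.

Lemma agree_catl X Y pi pi' : agree (X ++ Y) pi pi' -> agree X pi pi'.
Proof. by move=> a x xX; apply: a; rewrite mem_cat xX. Qed.

Lemma agree_catr X Y pi pi' : agree (X ++ Y) pi pi' -> agree Y pi pi'.
Proof. by move=> a x xX; apply: a; rewrite mem_cat xX orbT. Qed.

Definition mergeable X pi u v := exists pi', [/\ good pi', agree X pi pi' & conn pi' s u v].

(** The data that the construction keeps track of: one straight end p of the
    strand of u, and one straight end c of the strand of v. *)
Record strands pi u v (p c : Gamma * bool) : Prop := Strands {
  strands_good : good pi;
  strands_clear1 : clearp pi s p;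
  strands_clear2 : clearp pi s c;
  strands_conn1 : conn pi s u p.1;
  strands_conn2 : conn pi s v c.1 }.

(** There is free room above p into which its strand can be led without meeting the
    end c. *)
Definition top pi (p c : Gamma * bool) := forall k x, coset s (p.1 + fsval h *+ k.+1) x ->
  untouched pi s x /\ ~ coset s c.1 x.

Lemma window_cover O n i pi (A : seq Gamma) : (i.*2.+1 <= n)%N ->
    (forall t x, ~ untouched pi t x -> x \in A) ->
    (forall a, a \in A -> exists o k,
        [/\ o \in O, (k < (i.*2.+1).*2)%N & coset s (o + fsval h *+ k) a]) ->
  forall x, ~ untouched pi s x -> row_of O n x.
Proof.
move=> le_in HA cov x /HA /cov [o [k [oO ki co]]]; exists o, k; split=> //.
by apply: leq_trans ki _; rewrite leq_double.
Qed.

(** With the ends c and p exposed, joining all couples leaves them partners. *)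
Lemma merge_aligned pi X u v p c d : strands pi u v p c -> p.2 = c.2 ->
  coset s (c.1 + fsval h *+ d.*2.+1) p.1 -> mergeable X pi u v.
Proof.
move=> [gd clp clc cup cvc] pc co; have [ok _ _] := gd.
have [A HA] := untouched_support gd.
have [O [i [uO trO o1O cov]]] := exists_window c.1 A.
(* Row 2i over o1 is the row of c, hence row 2j + 1 is the row of p. *)
set o1 := c.1 - _ in o1O; pose j := (i + d)%N; pose n := (i.*2.+1 + d)%N.
have ij : (i <= j)%N by apply: leq_addr.
have jn : (j < n)%N by rewrite /j /n; lia.
have [N N0 HN] := far_ports (window O o1 c.2 i j n) gd.
have cvr : forall x, ~ untouched pi s x -> row_of O n x.
  by apply: window_cover HA cov; apply: leq_addr.
pose lc := (o1, i.*2, c.2); pose lp := (o1, j.*2.+1, c.2).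
have lcw : lc \in window O o1 c.2 i j n by rewrite mem_cat !inE eqxx.
have lpw : lp \in window O o1 c.2 i j n by rewrite mem_cat !inE eqxx orbT.
have cc : conn pi s c.1 (port N lc).1.
  apply: conn_clear_coset (clc) (HN _ lcw) _ => //.
  by apply: coset_trans (coset_shift _ _ _ _); rewrite /o1 subrK; apply: coset_refl.
have cp : conn pi s p.1 (port N lp).1.
  have := clp; rewrite /clearp pc => clp'.
  apply: conn_clear_coset (clp') (HN _ lpw) _ => //.
  apply: coset_trans (coset_shift _ _ _ _); apply: coset_trans (coset_sym co) _ => /=.
  have -> : j.*2.+1 = (i.*2 + d.*2.+1)%N by rewrite /j; lia.
  by rewrite /o1 mulrnDr; exists 0; zmod.
have [Y HY] := freeze pi s [:: u; v; (port N lp).1; (port N lc).1].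
have [pi' [g' ag pR _ _]] := join_window uO trO o1O ij jn (X ++ Y) gd N0 cvr HN (perm_refl _).
exists pi'; split=> //; first exact: agree_catl ag.
have [ok' _ _] := g'; have {}HY := HY _ (agree_catr ag).
have cu : conn pi' s u (port N lp).1.
  by apply: HY; rewrite ?inE ?eqxx ?orbT //; apply: conn_trans cp.
have cv : conn pi' s v (port N lc).1.
  by apply: HY; rewrite ?inE ?eqxx ?orbT //; apply: conn_trans cc.
have [|q + [qc cq]] := pR (port N lc); first by rewrite inE eqxx.
rewrite !inE => /orP[/eqP //|/eqP E]; rewrite E in cq.
by apply: (conn_trans ok' cu); apply: conn_sym => //; apply: conn_trans cq.
Qed.

(** The exposed ends are p and a new end q in the top row of the window; the couple
    that contains c is set aside as well.  After joining the other couples, the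
    partner of p is q, or c, or the mate x of c.  In the first case the end of u
    was moved to q, and in the second u and v are merged.  In the third case c
    and q are partners and joining c and x merges u and v. *)
Lemma relocate pi X u v p c : strands pi u v p c -> mergeable X pi u v \/
  exists pi' q c', [/\ strands pi' u v q c', agree X pi pi', top pi' q c',
    coset s c.1 c'.1 /\ c'.2 = c.2 &
    q.2 = p.2 /\ exists d, coset s (p.1 + fsval h *+ d.*2.+1) q.1].
Proof.
move=> [gd clp clc cup cvc]; have [ok _ _] := gd.
have [cpc|ncpc] := pselect (conn pi s p.1 c.1).
  left; exists pi; split=> //; apply: (conn_trans ok cup); apply: (conn_trans ok cpc).
  exact: conn_sym.
have [A HA] := untouched_support gd.
have [O [i [uO trO o1O cov]]] := exists_window p.1 (c.1 :: A).
(* Row 2j + 1 = 4i + 3 is the top row and lies above all touched vertices and c. *)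
set o1 := p.1 - _ in o1O; pose j := i.*2.+1; pose n := i.*2.+2.
have ij : (i <= j)%N by rewrite /j; lia.
have jn : (j < n)%N by rewrite /j /n; lia.
have row_lt r : (r < (i.*2.+1).*2)%N -> (r < n.*2)%N by rewrite /n; lia.
have row_lt_j r : (r < (i.*2.+1).*2)%N -> r <> j.*2.+1 by rewrite /j; lia.
have row_top r : (j.*2.+1 + r.+1 < n.*2)%N = false by rewrite /j /n; lia.
have jE : j.*2.+1 = (i.*2 + (j - i).*2.+1)%N by rewrite /j; lia.
have {}HA t x : ~ untouched pi t x -> x \in c.1 :: A by move/HA; rewrite inE => ->; rewrite orbT.
have cvr : forall x, ~ untouched pi s x -> row_of O n x.
  by apply: window_cover HA cov; rewrite /n.
set WW := window O o1 p.2 i j n.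
have [N N0 HN] := far_ports WW gd.
pose lp := (o1, i.*2, p.2); pose lq := (o1, j.*2.+1, p.2).
have [|o [k [oO ki cok]]] := cov c.1; first by rewrite inE eqxx.
pose lc := (o, k, c.2).
have lcw : lc \in WW by rewrite mem_window //= oO row_lt.
have lpw : lp \in WW by rewrite mem_cat !inE eqxx.
have lqw : lq \in WW by rewrite mem_cat !inE eqxx orbT.
have cc : conn pi s c.1 (port N lc).1.
  apply: conn_clear_coset (clc) (HN _ lcw) _ => //.
  exact: coset_trans (coset_sym cok) (coset_shift _ _ _ _).
have cp : conn pi s p.1 (port N lp).1.
  apply: conn_clear_coset (clp) (HN _ lpw) _ => //.
  by apply: coset_trans (coset_shift _ _ _ _); rewrite /o1 subrK; apply: coset_refl.
have lcp : lc <> lp.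
  by move=> E; apply: ncpc; apply: (conn_trans ok cp); rewrite -E; apply: conn_sym.
have lcq : lc <> lq by case=> _ E _; case: (row_lt_j _ ki E).
have [w wl lcE] : exists2 w, w \in lows O o1 p.2 i j n & lc = w \/ lc = upl w.
  move: lcw; rewrite mem_cat mem_cat !inE => /or3P[/orP[/eqP//|/eqP//]|lw|/mapP[w wl E]].
    by exists lc => //; left.
  by exists w => //; right.
have [lx lxE] : exists lx, forall l, (l \in [:: lp; lq; w; upl w]) = (l \in [:: lp; lq; lc; lx]).
  case: lcE => ->; [exists (upl w)|exists w] => l //.
  by rewrite !inE; congr [|| _, _ | _]; rewrite orbC.
pose R0 := [:: lp; lq; w; upl w]; pose W0 := rem w (lows O o1 p.2 i j n).
have pw : perm_eq (R0 ++ W0 ++ map upl W0) WW.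
  rewrite /WW /window /R0 /=; rewrite !perm_cons.
  have pr := perm_to_rem wl; have pr' := perm_map upl pr.
  apply/seq.permP => a; move/seq.permP/(_ a): pr; move/seq.permP/(_ a): pr'.
  by rewrite /= !count_cat /W0 => -> ->; clear; lia.
have R0w l : l \in R0 -> l \in WW by rewrite -(perm_mem pw) mem_cat => ->.
have [Y HY] := freeze pi s [:: u; v; (port N lp).1; (port N lc).1].
have [pi1 [g1 ag1 pR clR un]] := join_window uO trO o1O ij jn (X ++ Y) gd N0 cvr HN pw.
have [ok1 _ _] := g1; have {}HY := HY _ (agree_catr ag1); have {}ag1 := agree_catl ag1.
have cu : conn pi1 s u (port N lp).1.
  by apply: HY; rewrite ?inE ?eqxx ?orbT //; apply: conn_trans cp.
have cv : conn pi1 s v (port N lc).1.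
  by apply: HY; rewrite ?inE ?eqxx ?orbT //; apply: conn_trans cc.
have partner l : l \in R0 -> exists l', [/\ l' \in [:: lp; lq; lc; lx], l' <> l &
    conn pi1 s (port N l).1 (port N l').1].
  move=> lR; have [|q /mapP[l' l'R ->] [ne cq]] := pR (port N l); first exact: map_f.
  by exists l'; rewrite -lxE; split=> // E; apply: ne; rewrite E.
have merge : conn pi1 s (port N lp).1 (port N lc).1 -> mergeable X pi u v.
  move=> H; exists pi1; split=> //; apply: (conn_trans ok1 cu); apply: (conn_trans ok1 H).
  exact: conn_sym.
have lcR : lc \in R0 by rewrite lxE !inE eqxx !orbT.
have lpR : lp \in R0 by rewrite inE eqxx.
have lqR : lq \in R0 by rewrite !inE eqxx orbT.
have [l1 [+ l1p c1]] := partner _ lpR; rewrite !inE => /or4P[/eqP//|/eqP E|/eqP E|/eqP E].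
- rewrite E in c1; right; exists pi1, (port N lq), (port N lc); split=> //.
  + by split=> //; [exact: clR|exact: clR|exact: (conn_trans ok1 cu)].
  + have notrow k' x : coset s ((port N lq).1 + fsval h *+ k'.+1) x -> ~ row_of O n x.
      move=> cx [o' [k2 [o'O k2n co']]].
      have cx' : coset s (o1 + fsval h *+ (j.*2.+1 + k'.+1)) x.
        by apply: coset_trans cx; exists (sgn p.2 * N%:Z); rewrite /port /shift /=; zmod.
      by have [_ E2] := row_unique trO o1O o'O cx' co'; move: k2n; rewrite -E2 row_top.
    move=> k' x cx; have nr := notrow _ _ cx; split.
      by apply: un => //; apply: contrapT => /cvr.
    move=> ccx; apply: nr; exists o, k; split=> //; first exact: row_lt.
    exact: coset_trans (coset_shift s c.2 N _) ccx.
  + by split=> //; apply: coset_trans (coset_sym cok) (coset_shift _ _ _ _).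
  + split=> //; exists (j - i)%N; exists (sgn p.2 * N%:Z).
    rewrite /port /shift /= /o1.
    by rewrite jE mulrnDr; zmod.
- by left; apply: merge; rewrite -E.
rewrite E in c1; have [l2 [+ l2c c2]] := partner _ lcR.
rewrite !inE => /or4P[/eqP E2|/eqP E2|/eqP//|/eqP E2]; rewrite E2 in c2; first last.
- by left; apply: merge; apply: (conn_trans ok1 c1); apply: conn_sym.
- have [Y2 HY2] := freeze pi1 s [:: u; v; (port N lp).1; (port N lq).1; (port N lc).1].
  have PE : ports [:: port N lp; port N lq] [:: port N w] = map (port N) R0.
    by rewrite /ports /= up_port.
  have R0inj : {in R0 &, injective (port N)}.
    by move=> l l' /R0w lw /R0w l'w; apply: port_inj lw l'w => //.
  have uR0 : uniq R0.
    have : uniq WW by apply: uniq_window.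
    by rewrite -(perm_uniq pw) cat_uniq; case/andP.
  have [||||pi2 [g2 ag2 pR2 _ _]] :=
    @join_pairs [:: port N w] pi1 (X ++ Y2) [:: port N lp; port N lq] g1;
    rewrite ?PE.
  + by rewrite map_inj_in_uniq.
  + move=> p' q' /mapP[l /R0w lw ->] /mapP[l' /R0w l'w ->] ne.
    by apply: disjoint_ports lw l'w _ => // ll'; apply: ne; rewrite ll'.
  + by move=> p' /mapP[l lR ->]; apply: clR.
  + exact: pR.
  have [ok2 _ _] := g2; have {}HY2 := HY2 _ (agree_catr ag2).
  left; exists pi2; split=> //; first exact: agree_trans ag1 (agree_catl ag2).
  have d1 : conn pi2 s u (port N lp).1 by apply: HY2; rewrite ?inE ?eqxx ?orbT.
  have d2 : conn pi2 s v (port N lc).1 by apply: HY2; rewrite ?inE ?eqxx ?orbT.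
  have d3 : conn pi2 s (port N lc).1 (port N lq).1 by apply: HY2; rewrite ?inE ?eqxx ?orbT.
  have [|q + [qc cq]] := pR2 (port N lp); first by rewrite inE eqxx.
  rewrite !inE => /orP[/eqP //|/eqP E3]; rewrite E3 in cq.
  apply: (conn_trans ok2 d1); apply: (conn_trans ok2 cq); apply: conn_sym => //.
  exact: conn_trans d3.
- by left; apply: merge; apply: conn_sym.
Qed.

Lemma mergeable_agree X pi pi' u v : agree X pi pi' -> mergeable X pi' u v ->
  mergeable X pi u v.
Proof. by move=> ag [pi2 [g2 a2 c2]]; exists pi2; split=> //; apply: agree_trans a2. Qed.

Lemma strands_mergeable pi X u v p c : strands pi u v p c -> conn pi s p.1 c.1 ->
  mergeable X pi u v.
Proof.
move=> [gd _ _ cu cv] pc; have [ok _ _] := gd.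
exists pi; split=> //; apply: (conn_trans ok cu); apply: (conn_trans ok pc).
exact: conn_sym.
Qed.

(** After the join the strand of u turns into the coset of y and follows it back to
    its other end, which has the opposite sign. *)
Lemma step_over pi X u v p c g e (y := nbr p.1 (g, e)) :
    strands pi u v p c -> ~ mergeable X pi u v ->
    (forall n : int, fsval g <> fsval s *~ n) ->
    (forall x, coset s y x -> untouched pi s x /\ ~ coset s c.1 x) ->
    (exists N, forall m, (N <= m)%N -> forall n : int,
      untouched pi g (shift s p.2 m p.1 + fsval g *~ n)) ->
  exists pi', [/\ strands pi' u v (y, ~~ p.2) c, agree X pi pi',
    (forall x, untouched pi s x -> ~ coset s p.1 x -> ~ coset s y x -> untouched pi' s x) &
    forall t x, t != s -> t != g -> untouched pi t x -> untouched pi' t x].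
Proof.
move=> st nm ng cy [N HN]; have [gd clp clc cu cv] := st; have [ok _ _] := gd.
have nco : ~ coset s p.1 y.
  move=> [n E]; case: e @y cy E => /= cy E.
    by apply: (ng n); apply: (eq_from_sub E); rewrite /nbr /=; zmod.
  by apply: (ng (- n)); apply: (eq_from_sub (esym E)); rewrite /nbr /=; zmod.
have ncon : ~ conn pi s y p.1.
  move=> cyp; apply: nco; apply: coset_sym; apply: conn_coset cyp => n.
  by have [] := cy (y + fsval s *~ n) (ex_intro _ n erefl).
have cly b : clear pi s y b by move=> m; have [] := cy _ (coset_shift s b m y).
have [Y HY] := freeze pi s [:: u; v; p.1; c.1].
have [pi' [g' ag cpy un unt]] : exists pi', [/\ good pi', agree (X ++ y :: Y) pi pi',
    conn pi' s p.1 y,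
    (forall w, untouched pi s w -> (forall m, w <> shift s p.2 m p.1) ->
       (forall m, w <> shift s p.2 m y) -> untouched pi' s w) &
    forall t w, t != s -> t != g -> untouched pi t w -> untouched pi' t w].
  case: e @y cy nco ncon cly => /= cy nco ncon cly.
    have yE : nbr p.1 (g, true) = p.1 + fsval g by rewrite /nbr /=; zmod.
    rewrite yE in ncon cly *; apply: join_rays => //; last by exists N.
    by move=> H; apply: ncon; apply: conn_sym.
  have yE : nbr p.1 (g, false) + fsval g = p.1 by rewrite /nbr /=; zmod.
  have [|||pi' [g' ag cc un unt]] :=
    @join_rays pi (X ++ nbr p.1 (g, false) :: Y) s g (nbr p.1 (g, false)) p.2
      gd ng (cly _); rewrite ?yE //.
    exists N => m Nm n; have -> : shift s p.2 m (nbr p.1 (g, false)) + fsval g *~ n =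
       shift s p.2 m p.1 + fsval g *~ (n - 1) by rewrite /shift /nbr /=; zmod.
    exact: HN.
  rewrite yE in cc un; exists pi'; split=> //.
    by apply: conn_sym => //; case: g'.
  by move=> w uw w1 w2; apply: un.
have [ok' _ _] := g'.
have agY : agree Y pi pi' by move=> x xY; apply: ag; rewrite mem_cat inE xY !orbT.
have fr x z : x \in [:: u; v; p.1; c.1] -> z \in [:: u; v; p.1; c.1] ->
  conn pi s x z -> conn pi' s x z by exact: HY.
exists pi'; split=> //; last first.
- move=> x ux n1 n2; apply: un => // m E; [apply: n1|apply: n2]; rewrite E; exact: coset_shift.
- exact: agree_catl ag.
split=> //.
- case=> [|m].
    move=> b; rewrite shift0 ag ?mem_cat ?inE ?eqxx ?orbT //.
    by have := cly true 0%N; rewrite shift0; apply.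
  apply: un; first exact: cly.
    move=> m' E; apply: nco; apply: coset_trans (coset_shift s p.2 m' _) _.
    by rewrite -E; apply: coset_sym; apply: coset_shift.
  move=> m' /= E; have : fsval s *~ (sgn p.2 * (m.+1 + m')%:Z) = 0.
    by apply: (eq_from_sub (esym E)); rewrite /shift sgnN; zmod.
  by move/mulz_eq0; case: p.2 => /=; lia.
- move=> m; apply: un; first exact: clc.
    move=> m' E; apply: nm; apply: (strands_mergeable _ st).
    exact: (conn_meet ok clp clc (esym E)).
  move=> m' E; have [_] := cy _ (coset_shift s p.2 m' y); apply; rewrite -E.
  exact: coset_shift.
- apply: (conn_trans ok' _ cpy); apply: fr cu; rewrite ?inE ?eqxx ?orbT //.
- by apply: fr cv; rewrite ?inE ?eqxx ?orbT.
Qed.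

Lemma coset_eql x y z : coset s x z -> x = y -> coset s y z.
Proof. by move=> c <-. Qed.

Lemma row_eq a (m m' : int) x : coset s (a + fsval h *~ m) x ->
  coset s (a + fsval h *~ m') x -> m = m'.
Proof.
move=> [n E] [n' E']; have [] : m = m' /\ n = n' => //.
by apply: (independent_row indep); apply: (eq_from_sub (etrans (esym E) E')); zmod.
Qed.

Lemma coset_same_line x y z : same_line x y -> coset s y z -> same_line x z.
Proof. by move=> [m [n ->]] [k ->]; exists m, (n + k); zmod. Qed.

(** Moving up one row reverses the sign, so that the row and the sign of the end
    are linked by parity. *)
Lemma raise k pi X u v p c (q := (p.1 + fsval h *+ k, p.2 (+) odd k)) :
    strands pi u v p c -> ~ mergeable X pi u v -> top pi p c ->
  exists pi', [/\ strands pi' u v q c, agree X pi pi', top pi' q c,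
    (forall x, untouched pi s x -> ~ same_line p.1 x -> untouched pi' s x) &
    forall t x, t != s -> t != h -> untouched pi t x -> untouched pi' t x].
Proof.
move=> st nm tp; rewrite /q {q}; elim: k => [|k [pi1 [st1 ag1 tp1 un1 unt1]]].
  by exists pi; rewrite mulr0n addr0 addbF -surjective_pairing; split.
have [||||pi' [st' ag' un' unt']] := @step_over pi1 X u v _ c h true st1.
- by move=> H; apply: nm; apply: mergeable_agree H.
- by move=> n; apply: independent_neq.
- move=> x cx; apply: (tp1 0%N); apply: (coset_eql cx).
  by rewrite /nbr /=; zmod.
- by apply: eventually_untouched => //; case: st1.
set y := nbr _ _ in st' un'.
have yE : y = p.1 + fsval h *+ k.+1 by rewrite /y /nbr /=; zmod.
exists pi'; rewrite -yE (_ : p.2 (+) odd k.+1 = ~~ (p.2 (+) odd k)); last first.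
  by rewrite /= addbN.
split=> //.
- exact: agree_trans ag1 ag'.
- move=> k' x /= cx.
  have cx0 (n : nat) : y + fsval h *+ k'.+1 = p.1 + fsval h *~ (k.+1 + k'.+1)%:Z.
    by rewrite yE; zmod.
  have [|ux ncx] := tp1 k'.+1 x.
    by apply: (coset_eql cx); rewrite /= yE; zmod.
  split=> //; rewrite (cx0 0%N) in cx; apply: un' => //.
    by move=> H; have := row_eq (m' := k%:Z) cx H; lia.
  rewrite yE => H; have := row_eq (m' := k.+1%:Z) cx H; lia.
- move=> x ux nl; apply: un'; first exact: un1.
    by move=> H; apply: nl; apply: coset_same_line H; exists k%:Z, 0 => /=; zmod.
  by move=> H; apply: nl; apply: coset_same_line H; exists k.+1%:Z, 0; rewrite yE; zmod.
- by move=> t x ts th ut; apply: unt' => //; apply: unt1.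
Qed.

(** For a generator g commensurable with s the lines of direction g do not leave
    the touched part by going out along s; moving up by h does it. *)
Lemma eventually_off_plane pi g x : good pi -> ~ independent s g ->
  exists N, forall k, (N <= k)%N -> forall m n : int,
    untouched pi g (x + fsval h *+ k + fsval s *~ m + fsval g *~ n).
Proof.
move=> gd dep; have [A HA] := untouched_support gd.
have [m0 [n0 [E0 m00]]] : exists m n : int, fsval g *~ m = fsval s *~ n /\ m <> 0.
  apply: contrapT => no; apply: dep => m n E; apply: contrapT => m0.
  by apply: no; exists m, n.
pose P k a := exists m n : int, x + fsval h *+ k + fsval s *~ m + fsval g *~ n = a.
have [a k k' [m [n <-]] [m' [n' E]]|N HN] := @eventually_none _ P A.
  have : fsval h *~ ((k'%:Z - k%:Z) * m0) = fsval s *~ ((m - m') * m0 + (n - n') * n0).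
    have E1 : fsval h *~ (k'%:Z - k%:Z) = fsval s *~ (m - m') + fsval g *~ (n - n').
      by apply: (eq_from_sub E); zmod.
    have E2 : fsval h *~ (k'%:Z - k%:Z) *~ m0 + fsval g *~ m0 *~ (n - n') =
        (fsval s *~ (m - m') + fsval g *~ (n - n')) *~ m0 + fsval s *~ n0 *~ (n - n').
      by rewrite E1 E0.
    by apply: (eq_from_sub E2); zmod.
  by move/indep/eqP; rewrite mulf_eq0 => /orP[]/eqP; lia.
exists N => k Nk m n; apply: contrapT => /HA /(HN k Nk); apply.
by exists m, n.
Qed.

(** The end is first raised so high that the neighbouring row, and the lines of
    direction g needed for the exchange, are untouched.  Raising changes only
    the colours s and h, hence does not spoil the lines of direction g. *)
Lemma cross_line pi X u v p c g e :
    (forall m n : int, fsval g <> fsval h *~ m + fsval s *~ n) ->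
    strands pi u v p c -> ~ mergeable X pi u v -> top pi p c ->
  exists pi' p', [/\ strands pi' u v p' c, agree X pi pi', top pi' p' c &
    same_line (nbr p.1 (g, e)) p'.1].
Proof.
move=> gn st nm tp; have [gd _ _ _ _] := st.
have [A HA] := untouched_support gd.
pose d := nbr p.1 (g, e).
pose P k a := coset s (d + fsval h *+ k) a.
have [a m n|N1 HN1] := @eventually_none _ P (c.1 :: A).
  by move=> H1 H2; have := row_eq (m := m%:Z) (m' := n%:Z) H1 H2; case.
have [N2 HN2] : exists N, forall k, (N <= k)%N -> independent s g \/ forall m n : int,
    untouched pi g (p.1 + fsval h *+ k + fsval s *~ m + fsval g *~ n).
  have [ind|dep] := pselect (independent s g); first by exists 0%N; left.
  by have [N HN] := eventually_off_plane p.1 gd dep; exists N => k Nk; right; apply: HN.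
pose k := maxn N1 N2.
have [pi1 [st1 ag1 tp1 un1 unt1]] := raise k st nm tp.
have off x : same_line d x -> ~ same_line p.1 x.
  move=> dx px; have [m [n E]] := same_line_trans dx (same_line_sym px).
  rewrite /d /nbr /= in E; case: (e) E => /= E.
    by apply: (gn (- m) (- n)); apply: (eq_from_sub (esym E)); zmod.
  by apply: (gn m n); apply: (eq_from_sub E); zmod.
have high j x : coset s (d + fsval h *+ (k + j)) x -> untouched pi s x /\ ~ coset s c.1 x.
  have kj : (N1 <= k + j)%N by apply: leq_trans (leq_addr _ _); rewrite leq_maxl.
  move=> cx; split.
    by apply: contrapT => /HA xA; apply: (HN1 _ kj x) => //; rewrite inE xA orbT.
  move=> ccx; apply: (HN1 _ kj c.1); first by rewrite inE eqxx.
  by apply: coset_trans cx _; apply: coset_sym.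
set p1 := (_, _) in st1 tp1; pose y := nbr p1.1 (g, e).
have yE : y = d + fsval h *+ k by rewrite /y /d /nbr /p1 /=; zmod.
have line j x : coset s (d + fsval h *+ j) x -> same_line d x.
  by move=> [n ->]; exists j%:Z, n; zmod.
have [||||pi' [st' ag' un' _]] := @step_over pi1 X u v _ c g e st1.
- by move=> H; apply: nm; apply: mergeable_agree H.
- by move=> n E; apply: (gn 0 n); rewrite E; zmod.
- move=> x; rewrite -/y yE => cx; have [|ux ncx] := high 0%N x; first by rewrite addn0.
  by split=> //; apply: un1 => //; apply: off; apply: line cx.
- have [ind|un] := HN2 k (leq_maxr _ _).
    by apply: eventually_untouched => //; case: st1.
  exists 0%N => m _ n; apply: unt1; last exact: un.
    apply/eqP => E; apply: (gn 0 1); rewrite E; zmod.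
  by apply/eqP => E; apply: (gn 1 0); rewrite E; zmod.
exists pi', (y, ~~ p1.2); split=> //; first exact: agree_trans ag1 ag'.
- move=> j x /=; rewrite yE => cx.
  have cx' : coset s (d + fsval h *+ (k + j.+1)) x.
    by apply: (coset_eql cx); zmod.
  have [ux ncx] := high _ _ cx'; split=> //; apply: un'.
  + by apply: un1 => //; apply: off; apply: line cx'.
  + move=> H; apply: (off x (line _ _ cx')); apply: coset_same_line H.
    by exists k%:Z, 0; rewrite /p1 /=; zmod.
  + rewrite -/y yE => H.
    have := row_eq (m := (k + j.+1)%:Z) (m' := k%:Z) cx' H; lia.
- by rewrite /= yE; exists k%:Z, 0; zmod.
Qed.

(** A free end can be moved to the plane Z h + Z s translated by d. *)
Definition reachable d := forall pi X u v p c,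
    strands pi u v p c -> ~ mergeable X pi u v -> top pi p c ->
  exists pi' p', [/\ strands pi' u v p' c, agree X pi pi', top pi' p' c &
    same_line (p.1 + d) p'.1].

Lemma same_line_refl x : same_line x x.
Proof. by exists 0, 0; rewrite !mulr0z !addr0. Qed.

Lemma reachable0 : reachable 0.
Proof.
move=> pi X u v p c st nm tp; exists pi, p; split=> //.
by rewrite addr0; apply: same_line_refl.
Qed.

Lemma reachableD x y : reachable x -> reachable y -> reachable (x + y).
Proof.
move=> rx ry pi X u v p c st nm tp.
have [pi1 [p1 [st1 ag1 tp1 l1]]] := rx _ _ _ _ _ _ st nm tp.
have [|pi2 [p2 [st2 ag2 tp2 l2]]] := ry _ X _ _ _ _ st1 _ tp1.
  by move=> H; apply: nm; apply: mergeable_agree H.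
exists pi2, p2; split=> //; first exact: agree_trans ag1 ag2.
apply: same_line_trans l2; case: l1 => m [n E]; exists m, n.
by apply: (eq_from_sub E); zmod.
Qed.

Lemma reachable_generator g e : reachable (fsval g *~ sgn e).
Proof.
move=> pi X u v p c st nm tp.
have [[m [n E]]|gn] := pselect (exists m n : int, fsval g = fsval h *~ m + fsval s *~ n).
  exists pi, p; split=> //; apply: same_line_sym.
  by exists (m * sgn e), (n * sgn e); rewrite E; zmod.
by apply: (@cross_line pi X u v p c g e) => // m n E; apply: gn; exists m, n.
Qed.

Lemma reachable_all : generates S -> forall d, reachable d.
Proof.
move=> gen d; suff [] : reachable d /\ reachable (- d) by [].
move: d; apply: (generates_ind gen) => [|x y [rx rx'] [ry ry']|g].
- by rewrite oppr0; split; apply: reachable0.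
- by rewrite opprB [y - x]addrC [x - y]addrC; split; rewrite addrC; apply: reachableD.
- split; first by rewrite -[fsval g]mulr1z; apply: (reachable_generator g true).
  by rewrite -[fsval g]mulr1z -mulrNz; apply: (reachable_generator g false).
Qed.

(** If the row distance is even, a relocation of the end of u, which keeps its sign,
    changes it by an odd number. *)
Lemma merge_level pi X u v p c r : strands pi u v p c -> p.2 = c.2 ->
  coset s (c.1 + fsval h *+ r) p.1 -> mergeable X pi u v.
Proof.
move=> st pc co; have [odr|evr] := boolP (odd r).
  apply: (merge_aligned (d := r./2) X st pc); apply: coset_eql co _.
  by rewrite -[in LHS](odd_double_half r) odr.
have [//|[pi' [q [c' [st' ag _ [cc c2] [q2 [d cq]]]]]]] := relocate X st.
apply: (mergeable_agree ag).
apply: (merge_aligned (d := (r./2 + d)%N) X st'); first by rewrite q2 c2.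
have rE : r = r./2.*2 by rewrite -[LHS](odd_double_half r) (negPf evr).
have -> : ((r./2 + d).*2.+1 = r + d.*2.+1)%N by rewrite doubleD -rE addnS.
case: co cq cc => m pE [n qE] [l cE]; exists (m + n - l).
by rewrite qE pE cE mulrnDr; zmod.
Qed.

(** The number of rows to be climbed is chosen such that the end of u comes not to
    lie below c and gets the sign of c. *)
Lemma merge_top pi X u v p c : strands pi u v p c -> ~ mergeable X pi u v ->
  top pi p c -> same_line c.1 p.1 -> False.
Proof.
move=> st nm tp [m [n E]].
(* Climbing |m| rows is enough not to be below c; one more may be needed for the
   sign. *)
pose k0 := absz m; pose k := (k0 + (p.2 (+) odd k0 (+) c.2))%N.
have [pi' [st' ag _ _ _]] := raise k st nm tp.
apply: nm; apply: (mergeable_agree ag); apply: (merge_level (r := absz (m + k%:Z)) X st').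
  rewrite /= /k oddD oddb; by case: p.2; case: c.2; case: odd.
exists n; rewrite /= E.
have -> : fsval h *+ absz (m + k%:Z) = fsval h *~ (m + k%:Z).
  by rewrite -[LHS]/(fsval h *~ (Posz _)) gez0_abs // /k /k0; lia.
zmod.
Qed.

Lemma merge pi X u v : generates S -> good pi -> mergeable X pi u v.
Proof.
move=> gen gd; apply: contrapT => nm.
have [p [clp cup]] := escape_conn s u gd; have [c [clc cvc]] := escape_conn s v gd.
have st : strands pi u v p c by [].
have [//|[pi1 [p1 [c1 [st1 ag1 tp1 _ _]]]]] := relocate X st.
have nm1 : ~ mergeable X pi1 u v by move=> H; apply: nm; apply: mergeable_agree H.
have [pi2 [p2 [st2 ag2 tp2 l2]]] := reachable_all gen (c1.1 - p1.1) st1 nm1 tp1.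
apply: (merge_top st2 (X := X)) => //.
  by move=> H; apply: nm1; apply: mergeable_agree H.
by move: l2; rewrite addrC subrK.
Qed.
End OneColour.

(** * Integer combinations of the generators *)

Hypothesis S_gen : generates S.

Lemma sum_generators x : exists a : S -> int, x = \sum_(t : S) fsval t *~ a t.
Proof.
move: x; apply: (generates_ind S_gen) => [|_ _ [a ->] [a' ->]|g].
- by exists (fun=> 0); rewrite big1 // => t _; rewrite mulr0z.
- exists (fun t => a t - a' t); rewrite -sumrB; apply: eq_bigr => t _.
  by rewrite mulrzBr.
- exists (fun t => (t == g)%:Z); rewrite (bigD1 g) //= eqxx mulr1z big1 ?addr0 // => t.
  by move/negPf->; rewrite mulr0z.
Qed.

(** Take for [ball n] the combinations with coefficients between - n and n. *)
Lemma exhaustion : exists ball : nat -> seq Gamma,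
  forall x, exists N, forall n, (N <= n)%N -> x \in ball n.
Proof.
pose comb n (r : {ffun S -> 'I_(n.*2.+1)}) : Gamma := \sum_(t : S) fsval t *~ (Posz (r t) - n%:Z).
exists (fun n => [seq comb n r | r <- enum {ffun S -> 'I_(n.*2.+1)}]) => x.
have [a ->] := sum_generators x; exists (\max_(t : S) absz (a t)) => n le_n.
apply/mapP; exists [ffun t => inord (absz (a t + n%:Z))]; first by rewrite mem_enum.
apply: eq_bigr => t _; rewrite ffunE; congr (_ *~ _).
have : (absz (a t) <= n)%N by apply: leq_trans le_n; apply: (leq_bigmax t).
by move=> le_a; rewrite inordK; lia.
Qed.

(** * One end forces two independent directions *)

(** If every generator is commensurable with s, some positive multiple M x of each x
    is a multiple of s, which defines a height on Gamma.  The vertices of small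
    height form a finite set, an edge cannot jump over it, and the two halves of
    Z s lie on different sides. *)

Section Dependent.
Variable s : S.
Hypothesis dep : forall t, ~ independent s t.

Lemma common_multiple : exists2 M : nat, (0 < M)%N &
  forall x, exists n : int, x *~ M = fsval s *~ n.
Proof.
have [M [M0 HM]] : exists M : int, M <> 0 /\
    forall t, t \in enum {: S} -> exists n : int, fsval t *~ M = fsval s *~ n.
  elim: (enum {: S}) => [|t L [M [M0 IH]]]; first by exists 1.
  have [m [n [E m0]]] : exists m n : int, fsval t *~ m = fsval s *~ n /\ m <> 0.
    apply: contrapT => no; case: (dep (t := t)) => m n E; apply: contrapT => m0.
    by apply: no; exists m, n.
  exists (M * m); split; first by move/eqP; rewrite mulf_eq0 => /orP[] /eqP.
  move=> t'; rewrite inE => /predU1P[->|/IH [k Ek]].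
    by exists (n * M); apply: (eq_from_sub (congr1 (fun y => y *~ M) E)); zmod.
  by exists (k * m); apply: (eq_from_sub (congr1 (fun y => y *~ m) Ek)); zmod.
exists (absz M); first by lia.
have {}HM t : exists n : int, fsval t *~ absz M = fsval s *~ n.
  have [|n E] := HM t; first by rewrite mem_enum.
  have [M1|M1] := leP 0 M; first by exists n; rewrite gez0_abs.
  by exists (- n); rewrite ltz0_abs // mulrNz E mulrNz.
apply: (generates_ind S_gen) => [|x y [n En] [m Em]|//].
  by exists 0; rewrite mul0rz mulr0z.
by exists (n - m); rewrite mulrzBl En Em; zmod.
Qed.

Lemma dependent_not_one_ended : ~ one_ended (Cayley_graph S).
Proof.
have [M M0 HM] := common_multiple.
pose height x (n : int) := x *~ M = fsval s *~ n.
have heightU x n n' : height x n -> height x n' -> n = n'.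
  by rewrite /height => -> /mulz_inj.
have heightD x y n m e : height x n -> height y m -> height (x + y *~ e) (n + m * e).
  by rewrite /height => Ex Ey; rewrite mulrzDl mulrzAC Ex Ey; zmod.
have bounded (L : seq Gamma) : exists B : nat, forall x n, x \in L -> height x n -> `|n| <= B%:Z.
  elim: L => [|x L [B HB]]; first by exists 0%N.
  have [n Hn] := HM x; exists (B + absz n)%N => y m; rewrite inE => /predU1P[->|yL] Hm.
    by rewrite (heightU _ _ _ Hm Hn); lia.
  by have := HB _ _ yL Hm; lia.
have [B HB] := bounded [seq fsval t | t <- enum {: S}].
pose slab : set Gamma := [set x | exists n, height x n /\ `|n| <= B%:Z].
have slab_finite : finite_set slab.
  have [q Hq] := choice (fun t : S => HM (fsval t)).
  (* Reducing coefficients modulo M, every vertex is a multiple of s plus one of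
     finitely many remainders. *)
  pose rest (r : {ffun S -> 'I_M}) : Gamma := \sum_(t : S) fsval t *~ Posz (r t).
  pose L := [seq rest r | r <- enum {ffun S -> 'I_M}].
  have [C HC] := bounded L.
  pose D := (B + C)%N.
  pose LL := [seq x + fsval s *~ (k%:Z - D%:Z) | x <- L, k <- iota 0 D.*2.+1].
  apply: (sub_finite_set _ (finite_seq LL)).
  move=> x [n [Hn nB]]; suff : x \in LL by [].
  have [a xE] := sum_generators x.
  pose r : {ffun S -> 'I_M} := [ffun t => Ordinal (ltn_pmod (absz (a t %% M)%Z) M0)].
  have rE t : Posz (r t) = (a t %% M)%Z.
    rewrite ffunE /=; have := ltz_pmod (a t) (d := M) M0; have := modz_ge0 (a t) (d := M).
    by move=> H1 H2; rewrite modn_small; lia.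
  pose k := \sum_(t : S) q t * (a t %/ M)%Z.
  have xE' : x = rest r + fsval s *~ k.
    rewrite xE /rest /k mulrz_sumr -big_split /=; apply: eq_bigr => t _.
    have Hqt : fsval t *~ M = fsval s *~ q t by exact: Hq.
    rewrite rE {1}(divz_eq (a t) M); move: (_ %/ _)%Z (_ %% _)%Z => d e.
    by apply: (eq_from_sub (congr1 (fun y => y *~ d) Hqt)); zmod.
  have rL : rest r \in L by apply: map_f; rewrite mem_enum.
  have [m Hm] := HM (rest r); have mC := HC _ _ rL Hm.
  have Hs : height (fsval s) M by [].
  have := heightU _ _ _ Hn; rewrite xE' => /(_ _ (heightD _ _ _ _ _ Hm Hs)) nE.
  have kD : `|k| <= D%:Z.
    move: nE nB mC (M0); rewrite /D; move: (k) => k'; clear; nia.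
  apply/allpairsP; exists (rest r, absz (k + D%:Z)); split; first exact: rL.
    by rewrite mem_iota /=; move: kD; clear; lia.
  rewrite /=; congr (_ + _ *~ _); move: kD; clear; lia.
move=> /(_ slab slab_finite) [C0 [_ C0U]].
pose G' := @delete_vertices (Cayley_graph S) slab.
have ray_off b j : ~ slab (fsval s *~ (sgn b * (B + j).+1%:Z)).
  move=> [n [Hn nB]].
  have Hn' : height (fsval s *~ (sgn b * (B + j).+1%:Z))
                    (sgn b * (B + j).+1%:Z * M).
    by rewrite /height; zmod.
  by have := heightU _ _ _ Hn Hn'; case: b {Hn Hn'} => /=; nia.
pose p b : Gamma := fsval s *~ (sgn b * (B + 0).+1%:Z).
have comp b : component_of G' (p b) = C0.
  apply/esym; apply: C0U; split; first by exists (p b) => //; apply: ray_off.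
  have pre : (fun j => fsval s *~ (sgn b * (B + j).+1%:Z)) @^-1` component_of G' (p b) = setT.
    apply/seteqP; split=> // j _ /=; split; first exact: ray_off.
    elim: j => [|j IH]; first exact: rt_refl.
    apply: rt_trans IH _; apply: rt_step.
    case: b {p} => /=.
      exists (fsval s *~ (sgn true * (B + j).+1%:Z), s); last by left; congr pair; rewrite /=; zmod.
      split; first exact: ray_off.
      have := ray_off true j.+1; congr (~ slab _); rewrite /=; zmod.
    exists (fsval s *~ (sgn false * (B + j.+1).+1%:Z), s);
      last by right; congr pair; rewrite /=; zmod.
    split; first exact: ray_off.
    have := ray_off false j; congr (~ slab _); rewrite /=; zmod.
  move=> /(finite_preimage (f := fun j => fsval s *~ (sgn b * (B + j).+1%:Z))) fin.
  apply: infinite_nat; rewrite -pre; apply: fin => j j' _ _ /mulz_inj.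
  by case: (b) => /=; lia.
have : component_of G' (p true) (p false).
  rewrite comp -(comp false); split; first exact: ray_off.
  exact: rt_refl.
move=> [_ path].
have pos x x' : clos_refl_trans _ (adjacent G') x x' ->
    (forall n, height x n -> B%:Z < n) -> forall n, height x' n -> B%:Z < n.
  have step y z : adjacent G' y z -> (forall n, height y n -> B%:Z < n) ->
      forall n, height z n -> B%:Z < n.
    move=> [[w t] /= [w1 w2] wE] Hy n Hn.
    have zs : ~ slab z by case: wE => -[? ?]; subst.
    have nB : ~ `|n| <= B%:Z by move=> nB; apply: zs; exists n.
    have [m Hm] := HM y; have mB := Hy _ Hm.
    have [l Hl] := HM (fsval t).
    have lB : `|l| <= B%:Z by apply: HB Hl; apply: map_f; rewrite mem_enum.
    have [e nE] : exists e, n = m + l * sgn e.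
      case: wE => -[wE1 wE2].
        exists true; apply: (heightU z) => //.
        by rewrite -wE2 wE1; apply: (heightD _ _ _ _ (sgn true)).
      exists false; apply: (heightU z) => //.
      have -> : z = y + fsval t *~ sgn false by rewrite -wE2 -wE1 /=; zmod.
      exact: heightD.
    by move: nE; case: e => /=; lia.
  elim=> {x x'}[y z yz H|//|y z w _ IH1 _ IH2 H]; first exact: step yz H.
  exact: IH2 (IH1 H).
have height_p b : height (p b) (sgn b * (B + 0).+1%:Z * M) by rewrite /height /p; zmod.
have := pos _ _ path _ _ (height_p false); rewrite /=.
have H n : height (p true) n -> B%:Z < n.
  by move=> /heightU/(_ (height_p true))->; move: M0; clear; rewrite /=; nia.
by move/(_ H); move: M0; clear; nia.
Qed.

End Dependent.

Lemma independent_direction s : one_ended (Cayley_graph S) -> exists t, independent s t.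
Proof.
move=> oe; apply: contrapT => no; apply: (dependent_not_one_ended (s := s)) oe.
by move=> t ind; apply: no; exists t.
Qed.

(** * Passing to the limit *)

Section Limit.
Hypothesis merge_any : forall s X pi u v, good pi -> mergeable s X pi u v.

(** The connections made hold in every colouring that agrees with the result on the
    set X', so they survive all later steps that leave X' alone. *)
Lemma merge_all (L : seq (S * Gamma * Gamma)) pi (X : seq Gamma) : good pi ->
  exists pi' (X' : seq Gamma), [/\ good pi', agree X pi pi', {subset X <= X'} &
    forall a, a \in L -> forall pi'', agree X' pi' pi'' -> conn pi'' a.1.1 a.1.2 a.2].
Proof.
elim: L pi X => [|t L IH] pi X gd.
  by exists pi, X; split=> // a; rewrite in_nil.
have [pi1 [g1 ag1 c1]] := @merge_any t.1.1 X pi t.1.2 t.2 gd.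
have [Y HY] := conn_local c1.
have [pi' [X' [g' ag' sub HL]]] := IH pi1 (X ++ Y) g1.
have YX' : {subset Y <= X'} by move=> x xY; apply: sub; rewrite mem_cat xY orbT.
exists pi', X'; split=> //.
- exact: agree_trans ag1 (agree_catl ag').
- by move=> x xX; apply: sub; rewrite mem_cat xX.
- move=> t'; rewrite inE => /predU1P[->|/HL //] pi'' ag''.
  apply: HY => x xY; rewrite ag'' ?YX' //; exact: (agree_catr ag').
Qed.

Lemma good_standard : good (fun=> 1%g).
Proof.
have un s x : untouched (fun=> 1%g) s x by move=> b; rewrite perm1.
split; last by exists [::].
  by move=> [x [t b]]; rewrite cross_untouched.
move=> s k [x b] k0; rewrite -/(step _ s) iter_straight; last by move=> m; apply: un.
by move=> [E]; move: k0; rewrite (@shift_inj s b x k 0%N) // shift0.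
Qed.

Lemma spanning_colouring : exists2 pi, colour_ok pi & forall s u v, conn pi s u v.
Proof.
have [ball Hball] := exhaustion.
pose node := ({c : colouring | good c} * seq Gamma)%type.
pose extends (a : nat * node) (b : node) :=
  [/\ agree a.2.2 (sval a.2.1) (sval b.1), {subset a.2.2 <= b.2}, {subset ball a.1 <= b.2} &
      forall s u v, u \in ball a.1 -> v \in ball a.1 ->
        forall pi, agree b.2 (sval b.1) pi -> conn pi s u v].
have /choice[nxt Hnxt] : forall a, exists a', extends a a'.
  move=> [n [[pi gd] X]]; rewrite /extends /=.
  pose L := [seq (su, v) | su <- [seq (s, u) | s <- enum {: S}, u <- ball n], v <- ball n].
  have [pi' [X' [g' ag' sub HL]]] := merge_all L (X ++ ball n) gd.
  exists (exist _ pi' g', X'); split=> /=.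
  - exact: agree_catl ag'.
  - by move=> x xX; apply: sub; rewrite mem_cat xX.
  - by move=> x xX; apply: sub; rewrite mem_cat xX orbT.
  - move=> s u v uB vB; apply: (HL (s, u, v)); apply/allpairsP; exists ((s, u), v); split=> //=.
    by apply/allpairsP; exists (s, u); split; rewrite ?mem_enum.
pose st := fix st n : node := if n is m.+1 then nxt (m, st m) else (exist _ _ good_standard, [::]).
pose col n := sval (st n).1; pose X n := (st n).2.
have agS n : agree (X n) (col n) (col n.+1) by have [] := Hnxt (n, st n).
have subS n : {subset X n <= X n.+1} by have [_] := Hnxt (n, st n).
have ballS n : {subset ball n <= X n.+1} by have [_ _] := Hnxt (n, st n).
have subX n k : {subset X n <= X (k + n)%N}.
  by elim: k => // k IH x /IH; apply: subS.
have agX n k : agree (X n) (col n) (col (k + n)%N).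
  elim: k => [|k IH]; first by [].
  by move=> x xX; rewrite -(IH x xX); apply: agS; apply: subX.
have /choice[N HN] : forall x, exists n, x \in X n.
  by move=> x; have [N HN] := Hball x; exists N.+1; apply: ballS; apply: HN.
pose pi x := col (N x) x.
have piE n : agree (X n) (col n) pi.
  move=> x xX; rewrite /pi; have [le_n|/ltnW le_N] := leqP n (N x).
    by rewrite -(subnK le_n); apply: agX.
  by rewrite -[in RHS](subnK le_N); apply/esym; apply: agX.
exists pi.
  move=> [x h]; pose y := nbr x (pi x h); pose n := maxn (N x) (N y).
  have xX : x \in X n by rewrite /n -(subnK (leq_maxl (N x) (N y))); apply: subX.
  have yX : y \in X n by rewrite /n -(subnK (leq_maxr (N x) (N y))); apply: subX.
  have [ok _ _] := svalP (st n).1; have := ok (x, h).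
  by rewrite /cross /= -/(col n) -(piE n x xX) -(piE n _ yX).
move=> s u v; have [n1 H1] := Hball u; have [n2 H2] := Hball v.
have [_ _ _] := Hnxt (maxn n1 n2, st (maxn n1 n2)); apply.
- by apply: H1; rewrite leq_maxl.
- by apply: H2; rewrite leq_maxr.
- exact: (piE (maxn n1 n2).+1).
Qed.

End Limit.

(** * The colour classes of the limit *)

Section Decomposition.
Variable pi : colouring.
Hypotheses (ok : colour_ok pi) (span : forall s u v, conn pi s u v).
Local Notation G := (Cayley_graph S).

(** The colour of the slot that holds the initial half of the edge. *)
Definition edge_colour (e : Gamma * S) : S := (((pi e.1)^-1)%g (e.2, true)).1.

Definition edge_at x h : Gamma * S := if h.2 then (x, h.1) else (nbr x h, h.1).

Lemma edge_colour_at x s b : edge_colour (edge_at x (pi x (s, b))) = s.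
Proof.
rewrite /edge_colour /edge_at; case Ek : (pi x (s, b)) => [g []] /=.
  by rewrite -Ek permK.
by have := ok (x, (s, b)); rewrite /cross /= Ek /other_half.
Qed.

Lemma edge_colour_head x g s : edge_colour (x, g) = s ->
  (((pi (nbr x (g, true)))^-1)%g (g, false)).1 = s.
Proof.
by move=> <-; have := ok (x, ((pi x)^-1)%g (g, true)); rewrite /cross /= permKV.
Qed.

Definition colour_class s : subgraph G :=
  @Subgraph G setT [set e | edge_colour e = s] (fun _ _ => conj I I).

Lemma half_edges_class s (x : Gamma) : half_edges (colour_class s) x =
  [set (edge_at x (pi x (s, i == 0%N)), ~~ (pi x (s, i == 0%N)).2) | i in `I_2].
Proof.
apply/seteqP; split=> [[[z g] b] [/= cz zx]|_ [i _ <-]]; last first.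
  split; first exact: edge_colour_at.
  rewrite /= /edge_at; case: (pi x _) => [g []] //=.
  exact: (nbr_other_half x (g, false)).
have sbs : (((pi x)^-1)%g (g, ~~ b)).1 = s.
  case: b zx => /= <- //.
  by have := edge_colour_head cz; rewrite /nbr /= mulr1z.
pose h := (g, ~~ b); pose sb := ((pi x)^-1)%g h.
exists (if sb.2 then 0 else 1)%N; first by case: sb.2.
have -> : (s, (if sb.2 then 0 else 1)%N == 0%N) = sb.
  have -> : ((if sb.2 then 0 else 1)%N == 0%N) = sb.2 by case: sb.2.
  by rewrite -[in LHS]sbs; apply/esym/surjective_pairing.
rewrite /sb permKV /h /edge_at /=; case: b zx {h sb sbs} => /= zx; rewrite -zx //.
by congr (_, _, _); rewrite /nbr /=; zmod.
Qed.

Lemma colour_class_regular s : regular_subgraph 2 (colour_class s).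
Proof.
move=> x _; rewrite half_edges_class; apply: inj_card_eq => i j.
rewrite !inE /= => i2 j2 [E /(congr1 negb)]; rewrite !negbK => E2.
have : pi x (s, i == 0%N) = pi x (s, j == 0%N).
  move: E E2; rewrite /edge_at; case: (pi x _) => [g c]; case: (pi x _) => [g' c'] /= E cc.
  by move: E; rewrite cc; case: c' {cc} => -[] => [|_] ->.
by move/perm_inj => -[]; case: i i2 {E E2} => [|[|i]] //; case: j j2 => [|[|j]].
Qed.

Lemma colour_class_connected s : connected_subgraph (colour_class s).
Proof.
split; first by exists (0 : Gamma).
move=> u v _ _; have [k [b [b' E]]] := span s u v.
elim: k u b E => [|k IH] u b E; first by case: E => -> _; apply: rt_refl.
move: E; rewrite iterSr; case Ep : (step pi s (u, b)) => [w c] /IH; apply: rt_trans.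
apply: rt_step; exists (edge_at u (pi u (s, b))); first exact: edge_colour_at.
have -> : w = nbr u (pi u (s, b)) by case: Ep => <-.
rewrite /edge_at /=; case: (pi u _) => [g []] /=; [left|right].
  by congr pair; rewrite /nbr /= mulr1z.
by congr pair; rewrite /nbr /=; zmod.
Qed.

Lemma colour_classes_decompose : infinite_set [set: Gamma] -> has_Hamilton_decomposition G.
Proof.
move=> infG; exists (range colour_class).
  move=> _ [s _ <-]; split=> //; split=> //.
    exact: colour_class_connected.
  exact: colour_class_regular.
split.
- apply/seteqP; split=> // e _.
  by exists (colour_class (edge_colour e)) => //; exists (edge_colour e).
- by move=> _ _ [s _ <-] [t _ <-] [e [/= <- <-]].
- by move=> _ [s _ <-]; exists (edge_at 0 (pi 0 (s, true))); apply: edge_colour_at.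
Qed.

End Decomposition.

End Colourings.

Theorem theorem1p1 (Gamma : zmodType) (S : {fset Gamma})
    (Gamma_infinite : infinite_set [set: Gamma])
    (S_generates : generates S)
    (S_infinite_order : forall g : Gamma, g \in S -> infinite_order g)
    (G_one_ended : one_ended (Cayley_graph S)) :
  has_Hamilton_decomposition (Cayley_graph S).
Proof.
have [|pi ok span] := @spanning_colouring Gamma S S_infinite_order S_generates.
  move=> s X pi u v gd.
  have [h ind] := independent_direction S_infinite_order S_generates s G_one_ended.
  exact: (merge S_infinite_order ind X u v S_generates gd).
exact: colour_classes_decompose ok span Gamma_infinite.
Qed.
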